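(* Let $1<p<\infty$ and $p'=p/(p-1)$. Let $(\Omega,\mathcal{F},(\mathcal{F}_t)_{t\ge 0},\mathbb{P})$ be a complete filtered probability space whose filtration is right continuous and such that $\mathcal{F}_0$ contains all $\mathcal{F}$-null sets. Let $X$ be a uniformly integrable, adapted, càdlàg martingale with values in a separable Hilbert space, and let $w$ be a weight with $Q_p(w)<\infty$. Then \[ \| X^{\ast} \|_{L^p (w)} \leqslant \frac{p^{p'}}{p - 1} Q_p (w)^{1 / (p - 1)} \| X \|_{L^p (w)} . \]
   Context: $X^{\ast}=\sup_{t\ge 0}|X_t|$ is the maximal function of $X$. Martingales are identified with their closures, e.g. $X=X_\infty$. A weight is a positive uniformly integrable martingale $w_t$, and we write $w=w_\infty$. The dual weight $u$ is defined by $u^p w=u$, i.e. $u=w^{-1/(p-1)}$; for a stopping time $\tau$, $w_\tau=\mathbb{E}[w\mid\mathcal{F}_\tau]$ and $u_\tau=\mathbb{E}[u\mid\mathcal{F}_\tau]$. The $A_p$ characteristic is \[ Q_p(w)=\sup_{\tau}\Big\| \mathbb{E}\Big[\Big(\tfrac{w_\tau}{w}\Big)^{1/(p-1)}\,\Big|\,\mathcal{F}_\tau\Big]^{p-1}\Big\|_{\infty}=\sup_\tau\|w_\tau u_\tau^{p-1}\|_\infty, \] the supremum over all adapted stopping times $\tau$. The weighted norm is $\|X\|_{L^p(w)}=(\mathbb{E}[|X_\infty|^p w])^{1/p}$ and $\|X^\ast\|_{L^p(w)}=(\mathbb{E}[(X^\ast)^p w])^{1/p}$. *)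

(* Defs.v *)
From HB Require Import structures.
From mathcomp Require Import all_boot all_order all_algebra.
From mathcomp Require Import all_classical all_reals all_analysis.
From mathcomp Require Import ess_sup_inf.
Set Implicit Arguments. Unset Strict Implicit. Unset Printing Implicit Defensive.
Import Order.TTheory GRing.Theory Num.Theory.
Import numFieldNormedType.Exports.
Local Open Scope classical_set_scope.
Local Open Scope ring_scope.

Section Defs.
Context {R : realType} {d : measure_display} {T : measurableType d}.

Definition meas_in {V : topologicalType} (G : set (set T)) (f : T -> V) :=
  forall O : set V, open O -> G (f @^-1` O).

Definition is_filtration (F : R -> set (set T)) :=
  (forall t, 0 <= t -> sigma_algebra setT (F t) /\ F t `<=` measurable) /\
  (forall s t, 0 <= s -> s <= t -> F s `<=` F t).

Definition right_continuous_filtration (F : R -> set (set T)) :=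
  forall t, 0 <= t -> F t = \bigcap_(s in [set s | t < s]) F s.

Definition F_inf (F : R -> set (set T)) : set (set T) :=
  <<s \bigcup_(t in [set t : R | 0 <= t]) F t >>.

Variable P : probability T R.

Definition complete_space :=
  forall N A : set T, measurable N -> P N = 0%E -> A `<=` N -> measurable A.

Definition F0_contains_null (F : R -> set (set T)) :=
  forall N : set T, measurable N -> P N = 0%E -> F 0 N.

Definition is_inner_product {V : normedModType R} (ip : V -> V -> R) :=
  (forall x y, ip x y = ip y x) /\
  (forall (a : R) x y z, ip (a *: x + y) z = a * ip x z + ip y z) /\
  (forall x, ip x x = `|x| ^+ 2).

Definition separable_space (V : topologicalType) :=
  exists D : set V, countable D /\ closure D = setT.

(** Martingale (w.r.t. F and P) with values in the Hilbert space (V, ip):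
    adapted, Bochner integrable, and E[X_t | F_s] = X_s for 0 <= s <= t;
    the last condition written as: for every h in V and A in F_s,
    int_A <X_t, h> dP = int_A <X_s, h> dP. *)
Definition H_martingale {V : normedModType R} (ip : V -> V -> R)
    (F : R -> set (set T)) (X : R -> T -> V) :=
  (forall t, 0 <= t -> meas_in (F t) (X t)) /\
  (forall t, 0 <= t -> P.-integrable setT (fun w => (`|X t w|)%:E)) /\
  (forall s t, 0 <= s -> s <= t -> forall (h : V) (A : set T), F s A ->
     (\int[P]_(w in A) (ip (X t w) h)%:E = \int[P]_(w in A) (ip (X s w) h)%:E)%E).

Definition H_unif_integrable {V : normedModType R} (X : R -> T -> V) :=
  forall eps : R, 0 < eps -> exists K : R, forall t, 0 <= t ->
    (\int[P]_(w in [set w | (K < `|X t w|)%R]) (`|X t w|)%:E <= eps%:E)%E.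

Definition cadlag {V : normedModType R} (X : R -> T -> V) :=
  forall w : T,
    (forall t, 0 <= t -> X s w @[s --> t^'+] --> X t w) /\
    (forall t, 0 < t -> cvg (X ^~ w @ t^'-)).

(** Xinf is the closure X_infinity of X: F_infinity-measurable, integrable and
    E[X_infinity | F_t] = X_t for every t >= 0. *)
Definition H_closure {V : normedModType R} (ip : V -> V -> R)
    (F : R -> set (set T)) (X : R -> T -> V) (Xinf : T -> V) :=
  meas_in (F_inf F) Xinf /\
  P.-integrable setT (fun w => (`|Xinf w|)%:E) /\
  (forall t, 0 <= t -> forall (h : V) (A : set T), F t A ->
     (\int[P]_(w in A) (ip (Xinf w) h)%:E = \int[P]_(w in A) (ip (X t w) h)%:E)%E).

Definition R_ip (x y : R) : R := x * y.

Definition weight (F : R -> set (set T)) (wt : R -> T -> R) (w : T -> R) :=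
  (forall t x, 0 <= t -> 0 < wt t x) /\ (forall x, 0 < w x) /\
  H_martingale R_ip F wt /\ H_unif_integrable wt /\ H_closure R_ip F wt w.

Definition stopping_time (F : R -> set (set T)) (tau : T -> \bar R) :=
  (forall x, (0 <= tau x)%E) /\
  (forall t, 0 <= t -> F t [set x | (tau x <= t%:E)%E]).

Definition F_tau (F : R -> set (set T)) (tau : T -> \bar R) : set (set T) :=
  [set A | F_inf F A /\
     forall t, 0 <= t -> F t (A `&` [set x | (tau x <= t%:E)%E])].

Definition cond_exp_nonneg (G : set (set T)) (f g : T -> \bar R) :=
  meas_in G g /\ (forall x, (0 <= g x)%E) /\
  (forall A, G A -> (\int[P]_(x in A) g x = \int[P]_(x in A) f x)%E).

Definition Qp (F : R -> set (set T)) (p : R) (w : T -> R) : \bar R :=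
  ereal_sup [set q | exists (tau : T -> \bar R) (wtau utau : T -> \bar R),
    [/\ stopping_time F tau,
        cond_exp_nonneg (F_tau F tau) (fun x => (w x)%:E) wtau,
        cond_exp_nonneg (F_tau F tau)
          (fun x => (w x `^ (- (p - 1)^-1))%:E) utau &
        q = ess_sup P (fun x => (wtau x * poweR (utau x) (p - 1))%E)]].

Definition maximal_fun {V : normedModType R} (X : R -> T -> V) (x : T) : \bar R :=
  ereal_sup [set (`|X t x|)%:E | t in [set t : R | 0 <= t]].

End Defs.

(* Main.v *)
Require Import Defs.
From HB Require Import structures.
From mathcomp Require Import all_boot all_order all_algebra.
From mathcomp Require Import all_classical all_reals all_analysis.
From mathcomp Require Import measurable_realfun ess_sup_inf ring lra.
Import Order.TTheory GRing.Theory Num.Theory.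
Import numFieldNormedType.Exports.
Set Implicit Arguments.
Unset Strict Implicit.
Unset Printing Implicit Defensive.
Local Open Scope classical_set_scope.
Local Open Scope ring_scope.

(** Write [u] for the dual weight, [w_t] and [u_t] for the conditional
    expectations of [w] and [u]. For finitely many times [t_0 < ... < t_N] put
    [N = max_j |X_(t_j)| / u_(t_j)]. Since [E[u | F_t] = u_t] and
    [|X_t| <= E[|X| | F_t]], the process [|X_t| / u_t] is a submartingale
    dominated by the conditional expectation of [|X| / u] for the measure
    [u dP], so Doob's inequality bounds [N] in [L^p(u)] by [p'] times the norm
    of [X] in [L^p(w)]. The [A_p] condition [w_t u_t^(p-1) <= Q] then gives
    [|X_t|^(p-1) w_t <= Q N^(p-1)], and a second use of Doob's inequality, for
    [w dP] with exponent [p'], bounds [max_j |X_(t_j)|^(p-1)]. Right continuity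
    and Fatou's lemma pass from finite grids to the maximal function. *)

(** * Sub-sigma-algebras and domination of integrals *)

(** Both uses of Doob's inequality are instances of [weighted_doob], which only asks that the
    integral of [s_j v] be at most that of [k] over every event of [G j]. This says that [s_j] is
    dominated by the conditional expectation of [k / v] under [v dP], without forming that
    expectation. The pairs [(v, k)] are [(u, |X|)] and [(w, Q N^(p-1))]. Since [w] is integrable
    while [u] need not be, integrability is asked of [v] or of [k], and [u_t] is built with values
    in the extended reals; the A_p condition makes it finite almost everywhere. Origin of the
    constant: at the level of p-th powers the first use contributes [p'^p], and the second, at
    exponent [p'] whose conjugate is [p], contributes [p^(p') Q^(p')]. The p-th root of the product
    is [p^(1/(p-1)) p' Q^(1/(p-1))], where [p^(1/(p-1)) p' = p^(p') / (p-1)]. *)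

Section sub_sigma_algebra.
Context {R : realType} {d : measure_display} {T : measurableType d}.
Implicit Types (G : set (set T)) (A : set T).

Definition sub_sigma G := sigma_algebra setT G /\ G `<=` measurable.

(** Measurability with respect to [G] is expressed on [g_sigma_algebraType G], the copy of [T]
    carrying the sigma-algebra generated by [G]; this equation identifies it with [G]. *)
Lemma sub_sigmaE G : sub_sigma G ->
  (measurable : set (set (g_sigma_algebraType G))) = G.
Proof. by move=> [sG _]; exact: measurable_g_measurableTypeE. Qed.

Lemma sub_sigma_measurable G A : sub_sigma G -> G A -> measurable A.
Proof. by move=> [_]; exact. Qed.

Lemma sub_sigma_preimage d' (U : measurableType d') G (f : T -> U) (B : set U) :
  sub_sigma G -> measurable_fun [set: g_sigma_algebraType G] f ->
  measurable B -> G (f @^-1` B).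
Proof.
move=> sG mf mB; rewrite -(sub_sigmaE sG) -[X in measurable X]setTI.
exact: mf.
Qed.

Lemma sub_sigma_measurable_fun d' (U : measurableType d') G (f : T -> U) :
  sub_sigma G -> measurable_fun [set: g_sigma_algebraType G] f ->
  measurable_fun [set: T] f.
Proof.
move=> sG mf _ B mB; rewrite setTI; apply: (sub_sigma_measurable sG).
exact: sub_sigma_preimage.
Qed.

Lemma sub_sigma_measurable_funS G1 G2 d' (U : measurableType d') (f : T -> U) :
  sub_sigma G1 -> sub_sigma G2 -> G1 `<=` G2 ->
  measurable_fun [set: g_sigma_algebraType G1] f ->
  measurable_fun [set: g_sigma_algebraType G2] f.
Proof.
move=> s1 s2 G12 mf _ B mB; rewrite setTI (sub_sigmaE s2); apply: G12.
exact: sub_sigma_preimage.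
Qed.

Lemma meas_in_measurable_fun G (f : T -> R) : sub_sigma G -> meas_in G f ->
  measurable_fun [set: g_sigma_algebraType G] f.
Proof.
move=> sG mf; apply: (measurability _ (RGenOpens.measurableE R)).
move=> _ [_ [a [b ->] <-]]; rewrite setTI (sub_sigmaE sG).
exact/mf/interval_open.
Qed.

Lemma open_emeasurable (O : set (\bar R)) : open O -> measurable O.
Proof.
move=> oO; exists (EFin @^-1` O).
  apply: open_measurable; rewrite openE => r Or.
  have : nbhs r%:E O by apply: open_nbhs_nbhs.
  by move/nbhs_EFin.
exists (O `&` [set -oo%E; +oo%E]); first by apply/ps_inftyP => x [].
apply/seteqP; split => [x [[r Or <-]//|[]//]|[r| |] Ox].
- by left; exists r.
- by right; split=> //; right.
- by right; split=> //; left.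
Qed.

Lemma measurable_fun_meas_in G (f : T -> \bar R) : sub_sigma G ->
  measurable_fun [set: g_sigma_algebraType G] f -> meas_in G f.
Proof.
by move=> sG mf O oO; apply: sub_sigma_preimage => //; exact: open_emeasurable.
Qed.

Lemma sub_sigmaI G A B : sub_sigma G -> G A -> G B -> G (A `&` B).
Proof. by move=> sG; rewrite -(sub_sigmaE sG); exact: measurableI. Qed.

Lemma sub_sigmaD G A B : sub_sigma G -> G A -> G B -> G (A `\` B).
Proof. by move=> sG; rewrite -(sub_sigmaE sG); exact: measurableD. Qed.

Lemma sub_sigma_lee G (f g : T -> \bar R) : sub_sigma G ->
  measurable_fun [set: g_sigma_algebraType G] f ->
  measurable_fun [set: g_sigma_algebraType G] g ->
  G [set x | (f x <= g x)%E].
Proof.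
move=> sG mf mg; rewrite -(sub_sigmaE sG) -[X in measurable X]setTI.
exact: (@measurable_lee _ (g_sigma_algebraType G)).
Qed.

Lemma sub_sigmaT G : sub_sigma G -> G setT.
Proof. by move=> sG; rewrite -(sub_sigmaE sG); exact: measurableT. Qed.

End sub_sigma_algebra.

(** * Running maxima of finite sequences *)

Section running_max.
Context {disp : Order.disp_t} {U : orderType disp}.
Implicit Types (f : nat -> U) (n m : nat).

Fixpoint runmax f n : U :=
  if n is m.+1 then Order.max (runmax f m) (f n) else f 0%N.

Lemma runmax_ub f n m : (m <= n)%N -> (f m <= runmax f n)%O.
Proof.
elim: n => [|n ih]; first by rewrite leqn0 => /eqP ->.
rewrite leq_eqVlt ltnS => /predU1P[->|/ih fm] /=; first by rewrite le_max lexx orbT.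
by rewrite le_max fm.
Qed.

Lemma runmax_le f n y : (forall m, (m <= n)%N -> (f m <= y)%O) ->
  (runmax f n <= y)%O.
Proof.
elim: n => [|n ih] fy; first exact: fy.
by rewrite /= ge_max fy// andbT ih// => m mn; rewrite fy// ltnW.
Qed.

Lemma runmaxS f n : (runmax f n <= runmax f n.+1)%O.
Proof. by rewrite /= le_max lexx. Qed.

Lemma runmax_cases f n :
  runmax f n.+1 = runmax f n \/ runmax f n.+1 = f n.+1.
Proof. by rewrite /=; case: (leP (runmax f n) (f n.+1)) => _; [right|left]. Qed.

End running_max.

(** Measurability is asked only up to index [n]: an adapted process is measurable for the
    sigma-algebra of time [n] only that far. *)
Lemma measurable_runmax d (T : measurableType d) (R : realType)
    (f : nat -> T -> R) n :
  (forall k, (k <= n)%N -> measurable_fun [set: T] (f k)) ->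
  measurable_fun [set: T] (fun x => runmax (f^~ x) n).
Proof.
elim: n => [|n ih] mf /=; first exact: mf.
by apply: measurable_maxr; [apply: ih => k kn; exact/mf/ltnW|exact: mf].
Qed.

Lemma emeasurable_runmax d (T : measurableType d) (R : realType)
    (f : nat -> T -> \bar R) n :
  (forall k, measurable_fun [set: T] (f k)) ->
  measurable_fun [set: T] (fun x => runmax (f^~ x) n).
Proof. by move=> mf; elim: n => [|n ih] //=; exact: measurable_maxe. Qed.

(** * Integral inequalities tested on the events of a sub-sigma-algebra *)

Section integral_domination.
Local Open Scope ereal_scope.
Context {R : realType} {d : measure_display} {T : measurableType d}.
Variables (P : {measure set T -> \bar R}) (G : set (set T)).
Hypothesis sG : sub_sigma G.

(** The event where the new term attains the maximum lies in [G], so [A] can be cut along it: the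
    hypothesis handles one piece and the induction the other. *)
Lemma integral_runmax_le (f : nat -> T -> \bar R) (k : T -> \bar R) :
  (forall j, measurable_fun [set: g_sigma_algebraType G] (f j)) ->
  (forall j x, 0 <= f j x) ->
  (forall j A, G A -> \int[P]_(x in A) f j x <= \int[P]_(x in A) k x) ->
  measurable_fun setT k -> (forall x, 0 <= k x) ->
  forall A n, G A ->
  \int[P]_(x in A) runmax (f^~ x) n <= \int[P]_(x in A) k x.
Proof.
move=> mf f0 fk mk k0 A n; elim: n A => [|n ih] A GA; first exact: fk.
pose g x := runmax (f^~ x) n.
have mg m : measurable_fun [set: g_sigma_algebraType G]
    (fun x : T => runmax (f^~ x) m) by exact: emeasurable_runmax.
have g0 m x : 0 <= runmax (f^~ x) m.
  by rewrite (le_trans (f0 0%N x))// (@runmax_ub _ _ (f^~ x)).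
pose B := [set x | g x <= f n.+1 x].
have GB : G B by apply: sub_sigma_lee => //; exact: mg.
have mA := sub_sigma_measurable sG GA; have mB := sub_sigma_measurable sG GB.
have [GAB GAD] := (sub_sigmaI sG GA GB, sub_sigmaD sG GA GB).
have mg' m : measurable_fun A (fun x : T => runmax (f^~ x) m).
  exact/measurable_funTS/(sub_sigma_measurable_fun sG).
have ABD : A = (A `&` B) `|` (A `\` B) by rewrite setUIDK.
have dAB : [disjoint A `&` B & A `\` B].
  by rewrite disj_set2E; apply/eqP; rewrite setDE setIACA setICr setI0.
rewrite [in leLHS]ABD [in leRHS]ABD !ge0_integral_setU//; last first.
- by rewrite -ABD.
- exact: measurableD.
- exact: measurableI.
- by rewrite -ABD; exact: measurable_funTS.
- exact: measurableD.
- exact: measurableI.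
apply: leeD.
  rewrite (eq_integral (f n.+1)); first exact: fk.
  by move=> x; rewrite inE => -[_ Bx]; apply/max_idPr.
rewrite (eq_integral g); first exact: ih.
move=> x; rewrite inE => -[_ /negP]; rewrite -ltNge => Bx.
exact/max_idPl/ltW.
Qed.

(** Serves two countable suprema: the norm as a supremum of inner products, and a conditional
    expectation as a supremum over truncations. *)
Lemma integral_lim_runmax_le (f : nat -> T -> \bar R) (k : T -> \bar R) :
  (forall j, measurable_fun [set: g_sigma_algebraType G] (f j)) ->
  (forall j x, 0 <= f j x) ->
  (forall j A, G A -> \int[P]_(x in A) f j x <= \int[P]_(x in A) k x) ->
  measurable_fun setT k -> (forall x, 0 <= k x) ->
  forall A, G A ->
  \int[P]_(x in A) limn (runmax (f^~ x)) <= \int[P]_(x in A) k x.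
Proof.
move=> mf f0 fk mk k0 A GA; have mA := sub_sigma_measurable sG GA.
have nd x : nondecreasing_seq (runmax (f^~ x)).
  by apply/nondecreasing_seqP => n; exact: runmaxS.
have mr n : measurable_fun A (fun x : T => runmax (f^~ x) n).
  exact/measurable_funTS/(sub_sigma_measurable_fun sG)/emeasurable_runmax.
have g0 m x : 0 <= runmax (f^~ x) m.
  by rewrite (le_trans (f0 0%N x))// (@runmax_ub _ _ (f^~ x)).
rewrite (@monotone_convergence _ _ _ P A mA (fun n x => runmax (f^~ x) n))//.
apply: lime_le; last by apply: nearW => n; exact: integral_runmax_le.
apply: ereal_nondecreasing_is_cvgn; apply/nondecreasing_seqP => n.
by apply: ge0_le_integral => // x _; exact: runmaxS.
Qed.

Import HBNNSimple.

(** A simple [phi] has its level sets in [G], where the hypothesis applies; the general case follows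
    by monotone convergence. Infinite values are allowed because [u_t] may take them. *)
Lemma integral_mul_le (f g phi : T -> \bar R) A :
  measurable_fun setT f -> (forall x, 0 <= f x) ->
  measurable_fun setT g -> (forall x, 0 <= g x) ->
  (forall B, G B -> \int[P]_(x in B) f x <= \int[P]_(x in B) g x) ->
  measurable_fun [set: g_sigma_algebraType G] phi -> (forall x, 0 <= phi x) ->
  G A ->
  \int[P]_(x in A) (phi x * f x) <= \int[P]_(x in A) (phi x * g x).
Proof.
move=> mf f0 mg g0 fg mphi phi0 GA; have mA := sub_sigma_measurable sG GA.
pose s := nnsfun_approx measurableT mphi.
have nds m n x : (m <= n)%N -> (s m x <= s n x)%R.
  by move=> mn; have /lefP := nd_nnsfun_approx measurableT mphi mn; exact.
have ms n : measurable_fun [set: T] (fun x => (s n x)%:E).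
  by apply: (sub_sigma_measurable_fun sG); exact/measurable_EFinP/measurable_funP.
have lims h : (forall x, 0 <= h x) -> measurable_fun setT h ->
    \int[P]_(x in A) ((s n x)%:E * h x) @[n --> \oo] -->
    \int[P]_(x in A) (phi x * h x).
  move=> h0 mh.
  have -> : \int[P]_(x in A) (phi x * h x) =
      \int[P]_(x in A) limn (fun n => (s n x)%:E * h x).
    apply: eq_integral => x _; apply/esym/cvg_lim => //.
    have sx : (s n x)%:E @[n --> \oo] --> phi x.
      by apply: (@cvg_nnsfun_approx _ _ _ _ measurableT _ mphi).
    (* Multiplication is discontinuous at [0 * +oo]. Where [h x] is infinite, the approximants
       vanish if [phi x] does, and otherwise are positive from some rank on. *)
    have [h_oo|h_fin] := eqVneq (h x) +oo; last first.
      apply: cvgeZr => //; rewrite ge0_fin_numE// lt_neqAle h_fin leey//.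
    have := phi0 x; rewrite le_eqVlt => /predU1P[p0|p0].
      rewrite -p0 mul0e; apply: cvg_near_cst; apply: nearW => n.
      suff -> : s n x = 0%R by rewrite mul0e.
      apply/eqP; rewrite eq_le; apply/andP; split; last exact: fun_ge0.
      rewrite -lee_fin /s nnsfun_approxE (le_trans (le_approx _ _ _))//.
      by rewrite -p0.
    rewrite h_oo gt0_muley//; apply: cvg_near_cst.
    have [N sN] : exists N, 0 < (s N x)%:E.
      apply: contrapT => /forallNP s0; move: p0; rewrite ltNge => /negP; apply.
      by apply: (cvge_to_le sx); apply: nearW => n; rewrite leNgt; exact/negP.
    exists N => // n /= Nn; rewrite gt0_muley//; apply: lt_le_trans sN _.
    by rewrite lee_fin; exact: nds.
  apply: cvg_monotone_convergence => //.
  - by move=> n; apply: emeasurable_funM; exact: measurable_funTS.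
  - by move=> n x _; rewrite mule_ge0// lee_fin.
  - move=> x _ m n mn; rewrite lee_wpmul2r// lee_fin.
    exact: nds.
have mB n y : G (s n @^-1` [set y]).
  by apply: (sub_sigma_preimage sG) => //; exact: measurable_funP.
have sE n h : (forall x, 0 <= h x) -> measurable_fun setT h ->
    \int[P]_(x in A) ((s n x)%:E * h x) =
    \sum_(y \in range (s n)) (y%:E * \int[P]_(x in A `&` s n @^-1` [set y]) h x).
  move=> h0 mh.
  have mBT y : measurable (s n @^-1` [set y] : set T).
    exact: (sub_sigma_measurable sG).
  have m1 y : measurable_fun A
     (fun x : T => (\1_(s n @^-1` [set y]) x)%:E * h x).
    apply: emeasurable_funM; last exact: measurable_funTS.
    by apply/measurable_EFinP; exact: measurable_indic.
  transitivity (\int[P]_(x in A) (\sum_(y \in range (s n))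
      (y%:E * ((\1_(s n @^-1` [set y]) x)%:E * h x)))).
    apply: eq_integral => x _; rewrite {1}fimfunE -fsumEFin// ge0_mule_fsuml.
      by apply: eq_fsbigr => y _; rewrite EFinM muleA.
    by move=> y; exact: nnfun_muleindic_ge0.
  rewrite ge0_integral_fsum//; last 2 first.
  - by move=> y; apply: measurable_funeM.
  - move=> y x _; rewrite muleA mule_ge0//; exact: nnfun_muleindic_ge0.
  apply: eq_fsbigr => y; rewrite inE => -[x _ <-].
  rewrite ge0_integralZl//; last 2 first.
  - by move=> z _; rewrite mule_ge0// lee_fin.
  - by rewrite lee_fin.
  congr (_ * _); rewrite integral_mkcondr; apply: eq_integral => z _.
  by rewrite epatch_indic muleC.
apply: (lee_cvg_to (lims f f0 mf) (lims g g0 mg)); apply: nearW => n.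
rewrite !sE//; apply: lee_fsum => // y [x _ <-].
by rewrite lee_wpmul2l ?lee_fin//; apply: fg; exact: sub_sigmaI.
Qed.

End integral_domination.

(** * Doob's inequality for a weighted measure *)

Section young.
Context {R : realType}.
Variable q : R.
Hypothesis q1 : 1 < q.

(** Young's inequality for [b] and [a^(q-1)] with exponents [q] and [q' = q / (q - 1)], using
    [(q - 1) q' = q]. *)
Lemma young_powR (a b : R) : 0 <= a -> 0 <= b ->
  b * a `^ (q - 1) <= b `^ q / q + a `^ q * (1 - q^-1).
Proof.
move=> a0 b0; have q1' := q1; have q0 : 0 < q by lra.
have qB0 : q - 1 != 0 by apply: lt0r_neq0; lra.
have qN0 : q != 0 by exact: lt0r_neq0.
have q'0 : 0 < q / (q - 1) by rewrite divr_gt0//; lra.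
have := @conjugate_powR R b (a `^ (q - 1)) q (q / (q - 1)) b0 (powR_ge0 _ _) q0 q'0.
rewrite invf_div -powRrM (_ : (q - 1) * (q / (q - 1)) = q); last first.
  by field; rewrite ?qB0 ?qN0.
have -> : (q - 1) / q = 1 - q^-1 by field; rewrite ?qB0 ?qN0.
by apply; ring.
Qed.

(** The left side is the integral of [x d(q' x^(q-1))] from [a] to [b], where [x <= b] if [a <= b].
    Young's inequality gives the bound without ordering [a] and [b]. This is where the factor [q']
    of Doob's inequality originates. *)
Lemma powR_increment_le (a b : R) : 0 <= a -> 0 <= b ->
  b `^ q - a `^ q <= b * (q / (q - 1) * (b `^ (q - 1) - a `^ (q - 1))).
Proof.
move=> a0 b0; have q1' := q1; have q0 : 0 < q by lra.
have qB0 : q - 1 != 0 by apply: lt0r_neq0; lra.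
have qN0 : q != 0 by exact: lt0r_neq0.
have bq : b * b `^ (q - 1) = b `^ q by rewrite mulr_powRB1.
have -> : b * (q / (q - 1) * (b `^ (q - 1) - a `^ (q - 1))) =
  q / (q - 1) * (b `^ q - b * a `^ (q - 1)) by rewrite -bq; ring.
rewrite -ler_pdivrMl ?divr_gt0//; last lra.
have := young_powR a0 b0.
have -> : (q / (q - 1))^-1 * (b `^ q - a `^ q) =
   b `^ q - b `^ q / q - a `^ q * (1 - q^-1) by field; rewrite ?qB0 ?qN0.
lra.
Qed.

End young.

Lemma runmax_min (R : realType) (f : nat -> R) (L : R) n :
  runmax (fun j => Order.min (f j) L) n = Order.min (runmax f n) L.
Proof. by elim: n => //= n ->; rewrite min_maxl. Qed.

Section measurable_powR_inv.
Context {R : realType} {d : measure_display} {T : measurableType d}.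
Implicit Type f : T -> R.

Lemma measurable_fun_powR f r : measurable_fun setT f ->
  measurable_fun setT (fun x => f x `^ r).
Proof. by move=> mf; exact: (measurableT_comp (measurable_powR r)). Qed.

Lemma measurable_fun_inv f : measurable_fun setT f -> (forall x, 0 <= f x) ->
  measurable_fun setT (fun x => (f x)^-1).
Proof.
move=> mf f0; under eq_fun do rewrite -powR_inv1//.
exact: measurable_fun_powR.
Qed.

End measurable_powR_inv.

Section doob.
Local Open Scope ereal_scope.
Context {R : realType} {d : measure_display} {T : measurableType d}.
Variables (P : {measure set T -> \bar R}) (G : nat -> set (set T)).
Hypothesis sG : forall j, sub_sigma (G j).
Hypothesis ndG : forall i j, (i <= j)%N -> G i `<=` G j.
Variables (v k : T -> R) (q : R).
Hypotheses (mv : measurable_fun setT v) (v0 : forall x, (0 < v x)%R).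
Hypotheses (mk : measurable_fun setT k) (k0 : forall x, (0 <= k x)%R).
Hypothesis q1 : (1 < q)%R.

Let v0' x : (0 <= v x)%R. Proof. exact/ltW. Qed.

Lemma measurable_runmax_sub (s : nat -> T -> R) n :
  (forall j, measurable_fun [set: g_sigma_algebraType (G j)] (s j)) ->
  measurable_fun [set: g_sigma_algebraType (G n)] (fun x => runmax (s^~ x) n).
Proof.
move=> ms; apply: measurable_runmax => j jn.
exact: (sub_sigma_measurable_funS (sG j) (sG n) (ndG jn)).
Qed.

(* Pathwise, [m_(j+1)^q - m_j^q <= s_(j+1) (Psi_(j+1) - Psi_j)] with
   [Psi_j = q' m_j^(q-1)], because the running maximum only moves when it equals
   [s_(j+1)]; this avoids any layer-cake argument. *)
Lemma doob_step (s : nat -> T -> R) n :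
  (forall j, measurable_fun [set: g_sigma_algebraType (G j)] (s j)) ->
  (forall j x, (0 <= s j x)%R) ->
  (forall j A, (j <= n)%N -> G j A ->
    \int[P]_(x in A) (s j x * v x)%:E <= \int[P]_(x in A) (k x)%:E) ->
  \int[P]_x (runmax (s^~ x) n `^ q * v x)%:E <=
  \int[P]_x (q / (q - 1) * runmax (s^~ x) n `^ (q - 1) * k x)%:E.
Proof.
move=> ms s0 sk; have q1' := q1.
have q'0 : (0 <= q / (q - 1))%R by rewrite divr_ge0//; lra.
have ms' j : measurable_fun [set: T] (s j).
  exact: sub_sigma_measurable_fun (sG j) (ms j).
pose m j x := runmax (s^~ x) j.
have mm j : measurable_fun [set: g_sigma_algebraType (G j)] (m j : T -> R).
  exact: measurable_runmax_sub.
have mm' j : measurable_fun [set: T] (m j).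
  exact: sub_sigma_measurable_fun (sG j) (mm j).
have m0 j x : (0 <= m j x)%R.
  by rewrite (le_trans (s0 0%N x))// (@runmax_ub _ _ (s^~ x)).
have int_psi j (psi : T -> R) : (j <= n)%N ->
    measurable_fun [set: g_sigma_algebraType (G j)] psi ->
    (forall x, (0 <= psi x)%R) ->
    \int[P]_x (psi x * (s j x * v x))%:E <= \int[P]_x (psi x * k x)%:E.
  move=> jn mpsi psi0; under eq_integral do rewrite EFinM.
  under [leRHS]eq_integral do rewrite EFinM.
  apply: (integral_mul_le (sG j)) => //.
  - by apply/measurable_EFinP; exact: measurable_funM.
  - by move=> x; rewrite lee_fin mulr_ge0.
  - exact/measurable_EFinP.
  - by move=> B; exact: sk.
  - exact/measurable_EFinP.
  - exact: sub_sigmaT.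
elim: n sk int_psi => [|n ih] sk int_psi.
  apply: le_trans (int_psi 0%N (fun x => q / (q - 1) * s 0%N x `^ (q - 1))%R _ _ _) => //.
  - apply: ge0_le_integral => //=.
    + by move=> x _; rewrite lee_fin mulr_ge0 ?powR_ge0.
    + by apply/measurable_EFinP/measurable_funM => //; exact: measurable_fun_powR.
    + apply/measurable_EFinP; apply: measurable_funM; last exact: measurable_funM.
      by apply: measurable_funM => //; exact: measurable_fun_powR.
    + move=> x _; rewrite lee_fin mulrA ler_wpM2r//.
      (* The first step is the increment of the maximum from the value 0. *)
      have := powR_increment_le q1 (lexx 0%R) (s0 0%N x).
      by rewrite !powR0 ?subr0 ?[leLHS]subr0; [lra|lra|lra].
  - apply: measurable_funM => //.
    exact: (measurableT_comp (measurable_powR _)).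
  - by move=> x; rewrite mulr_ge0 ?powR_ge0.
have ih' := ih (fun j A jn => sk j A (leqW jn)) (fun j f jn => int_psi j f (leqW jn)).
pose psi x := (q / (q - 1) * (m n.+1 x `^ (q - 1) - m n x `^ (q - 1)))%R.
have psi0 x : (0 <= psi x)%R.
  rewrite mulr_ge0// subr_ge0 ge0_ler_powR ?nnegrE//; first lra.
  exact: (@runmaxS _ _ (s^~ x)).
have mpsi : measurable_fun [set: g_sigma_algebraType (G n.+1)] (psi : T -> R).
  apply: measurable_funM => //; apply: measurable_funB.
    exact: (measurableT_comp (measurable_powR _) (mm n.+1)).
  apply: (measurableT_comp (measurable_powR _)).
  exact: (sub_sigma_measurable_funS (sG n) (sG n.+1) (ndG (leqnSn n))).
have {int_psi} psi_le := int_psi n.+1 psi (leqnn _) mpsi psi0.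
clear sk ih.
have mpsi' : measurable_fun [set: T] psi := sub_sigma_measurable_fun (sG n.+1) mpsi.
have key x : (m n.+1 x `^ q <= m n x `^ q + psi x * s n.+1 x)%R.
  have := powR_increment_le q1 (m0 n x) (m0 n.+1 x).
  rewrite -/(psi x) /psi; case: (runmax_cases (s^~ x) n); rewrite -!/(m _ x) => -> //.
    by rewrite !subrr !mulr0 mul0r addr0.
  by rewrite lerBlDl mulrC.
apply: (@le_trans _ _ (\int[P]_x
    ((m n x `^ q * v x)%:E + (psi x * (s n.+1 x * v x))%:E))).
  apply: ge0_le_integral => //=.
  - by move=> x _; rewrite lee_fin mulr_ge0 ?powR_ge0.
  - apply/measurable_EFinP/measurable_funM => //.
    exact: (measurable_fun_powR _ (mm' n.+1)).
  - apply: emeasurable_funD; apply/measurable_EFinP.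
      by apply: measurable_funM => //; exact: measurable_fun_powR.
    by apply: measurable_funM => //; exact: measurable_funM.
  - by move=> x _; rewrite -EFinD lee_fin mulrA -mulrDl ler_wpM2r//; exact: key.
rewrite ge0_integralD; last 5 first.
- exact: measurableT.
- by move=> x _; rewrite lee_fin mulr_ge0 ?powR_ge0.
- by apply/measurable_EFinP/measurable_funM => //; exact: measurable_fun_powR.
- by move=> x _; rewrite lee_fin mulr_ge0// mulr_ge0.
- by apply/measurable_EFinP/measurable_funM => //; exact: measurable_funM.
(* The sum telescopes: [q' m_n^(q-1) + psi] equals [q' m_(n+1)^(q-1)]. *)
apply: le_trans (leeD ih' psi_le) _.
rewrite -ge0_integralD; last 5 first.
- exact: measurableT.
- by move=> x _; rewrite lee_fin mulr_ge0// mulr_ge0 ?powR_ge0.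
- apply/measurable_EFinP/measurable_funM => //; apply: measurable_funM => //.
  exact: (measurable_fun_powR _ (mm' n)).
- by move=> x _; rewrite lee_fin mulr_ge0.
- by apply/measurable_EFinP/measurable_funM.
apply: ge0_le_integral => //=.
- by move=> x _; rewrite -EFinD lee_fin addr_ge0// mulr_ge0// mulr_ge0 ?powR_ge0.
- apply/measurable_EFinP/measurable_funD; last exact: measurable_funM.
  apply: measurable_funM => //; apply: measurable_funM => //.
  exact: (measurable_fun_powR _ (mm' n)).
- apply/measurable_EFinP/measurable_funM => //.
  by apply: measurable_funM => //; exact: (measurable_fun_powR _ (mm' n.+1)).
- by move=> x _; rewrite -EFinD lee_fin -mulrDl ler_wpM2r// /psi; lra.
Qed.

(** Young's inequality makes the left side [I] reappear on the right with factor [1 - 1/q].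
    Absorbing it requires [I] to be finite, which is what the bound [L] and the integrability of [v]
    or [k] provide. *)
Lemma doob_bounded (s : nat -> T -> R) n L :
  (forall j, measurable_fun [set: g_sigma_algebraType (G j)] (s j)) ->
  (forall j x, (0 <= s j x)%R) ->
  (forall j A, (j <= n)%N -> G j A ->
    \int[P]_(x in A) (s j x * v x)%:E <= \int[P]_(x in A) (k x)%:E) ->
  (forall j x, (s j x <= L)%R) ->
  \int[P]_x (v x)%:E < +oo \/ \int[P]_x (k x)%:E < +oo ->
  \int[P]_x (runmax (s^~ x) n `^ q * v x)%:E <=
  \int[P]_x ((q / (q - 1)) `^ q * ((k x / v x) `^ q * v x))%:E.
Proof.
move=> ms s0 sk sL fin; have q1' := q1; have q0 : (0 < q)%R by lra.
have {sk} step := doob_step ms s0 sk.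
have q'0 : (0 <= q / (q - 1))%R by rewrite divr_ge0//; lra.
pose m x := runmax (s^~ x) n.
have mm : measurable_fun [set: T] m.
  exact: sub_sigma_measurable_fun (sG n) (measurable_runmax_sub ms).
have m0 x : (0 <= m x)%R.
  by rewrite (le_trans (s0 0%N x))// (@runmax_ub _ _ (s^~ x)).
have mL x : (m x <= L)%R by apply: runmax_le => j _; exact: sL.
have mLHS : measurable_fun setT (fun x => (m x `^ q * v x)%:E).
  by apply/measurable_EFinP/measurable_funM => //; exact: measurable_fun_powR.
have mh : measurable_fun setT (fun x => (k x / v x) `^ q * v x)%R.
  apply: measurable_funM => //; apply: measurable_fun_powR; apply: measurable_funM => //.
  exact: measurable_fun_inv.
set J := leRHS; have J0 : 0 <= J.
  by apply: integral_ge0 => x _; rewrite lee_fin !mulr_ge0 ?powR_ge0.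
set I := leLHS; have I0 : 0 <= I.
  by apply: integral_ge0 => x _; rewrite lee_fin !mulr_ge0 ?powR_ge0.
have IJ : I <= (q^-1)%:E * J + (1 - q^-1)%:E * I.
  have qV : (0 <= 1 - q^-1)%R by rewrite subr_ge0 invf_le1// ltW.
  have qV0 : (0 <= q^-1)%R by rewrite invr_ge0 ltW.
  (* Young: [(q' k / v) m^(q-1) v <= ((q' k / v)^q / q + m^q / q') v]. *)
  apply: (le_trans step).
  rewrite -!ge0_integralZl//; last 3 first.
  - by move=> x _; rewrite lee_fin mulr_ge0 ?powR_ge0.
  - exact/measurable_EFinP/measurable_funM.
  - by move=> x _; rewrite lee_fin !mulr_ge0 ?powR_ge0.
  rewrite -ge0_integralD//; last 4 first.
  - by move=> x _; rewrite -EFinM lee_fin mulr_ge0// !mulr_ge0 ?powR_ge0.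
  - apply: measurable_funeM.
    exact/measurable_EFinP/measurable_funM.
  - by move=> x _; rewrite -EFinM lee_fin mulr_ge0// mulr_ge0 ?powR_ge0.
  - exact: measurable_funeM.
  apply: ge0_le_integral => //.
  - by move=> x _; rewrite lee_fin mulr_ge0// mulr_ge0 ?powR_ge0.
  - apply/measurable_EFinP/measurable_funM => //.
    by apply: measurable_funM => //; exact: (measurable_fun_powR _ mm).
  - apply: emeasurable_funD; apply: measurable_funeM => //.
    exact/measurable_EFinP/measurable_funM.
  move=> x _; rewrite -!EFinM -EFinD lee_fin.
  have h0 : (0 <= k x / v x)%R by rewrite divr_ge0.
  have := young_powR q1 (m0 x) (mulr_ge0 q'0 h0).
  rewrite (powRM _ q'0 h0) => /(ler_wpM2r (v0' x)).
  have -> : (q / (q - 1) * (k x / v x) * m x `^ (q - 1) * v x =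
      q / (q - 1) * m x `^ (q - 1) * k x)%R.
    rewrite -[in RHS](divfK (lt0r_neq0 (v0 x)) (k x)).
    by ring.
  by move=> /le_trans; apply; rewrite le_eqVlt; apply/orP; left; apply/eqP; ring.
have Ifin : I < +oo.
  have qL r : (0 <= r)%R -> forall x, (m x `^ r <= `|L| `^ r)%R.
    move=> r0 x; rewrite ge0_ler_powR ?nnegrE//.
    by rewrite (le_trans (mL x))// ler_norm.
  have [vfin|kfin] := fin.
    apply: (@le_lt_trans _ _ ((`|L| `^ q)%:E * \int[P]_x (v x)%:E)).
      rewrite -ge0_integralZl; last 4 first.
      - exact: measurableT.
      - exact/measurable_EFinP.
      - by move=> x _; rewrite lee_fin.
      - by rewrite lee_fin powR_ge0.
      apply: ge0_le_integral => //.
      - by move=> x _; rewrite lee_fin mulr_ge0 ?powR_ge0.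
      - by apply: measurable_funeM; exact/measurable_EFinP.
      - by move=> x _; rewrite -EFinM lee_fin ler_wpM2r// qL// ltW.
    by rewrite lte_mul_pinfty// lee_fin powR_ge0.
  (* If only [k] is integrable, the bound [L] on the maximum does not control [I] directly; it
     controls the right side of [doob_step]. *)
  apply: (le_lt_trans step).
  have C0 : (0 <= q / (q - 1) * `|L| `^ (q - 1))%R by rewrite mulr_ge0// powR_ge0.
  apply: (@le_lt_trans _ _ ((q / (q - 1) * `|L| `^ (q - 1))%:E * \int[P]_x (k x)%:E)).
    rewrite -ge0_integralZl; last 4 first.
    - exact: measurableT.
    - exact/measurable_EFinP.
    - by move=> x _; rewrite lee_fin.
    - by rewrite lee_fin.
    apply: ge0_le_integral => //.
    - by move=> x _; rewrite lee_fin mulr_ge0// mulr_ge0 ?powR_ge0.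
    - apply/measurable_EFinP/measurable_funM => //.
      by apply: measurable_funM => //; exact: (measurable_fun_powR _ mm).
    - by apply: measurable_funeM; exact/measurable_EFinP.
    - move=> x _; rewrite -EFinM lee_fin ler_wpM2r// ler_wpM2l// qL//.
      by rewrite subr_ge0 ltW.
  by rewrite lte_mul_pinfty// lee_fin.
have [Joo|Jfin] := eqVneq J +oo; first by rewrite Joo leey.
have {}Jfin : J \is a fin_num by rewrite ge0_fin_numE// lt_neqAle Jfin leey.
have {}Ifin : I \is a fin_num by rewrite ge0_fin_numE.
move: IJ; rewrite -(fineK Jfin) -(fineK Ifin) -!EFinM -EFinD !lee_fin => IJ.
have qi : (0 < q^-1)%R by rewrite invr_gt0.
by rewrite -(ler_pM2l qi); lra.
Qed.

(** Truncating [s] at level [i] preserves the hypothesis and commutes with the running maximum;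
    monotone convergence in [i] then removes the bound. *)
Lemma weighted_doob (s : nat -> T -> R) n :
  (forall j, measurable_fun [set: g_sigma_algebraType (G j)] (s j)) ->
  (forall j x, (0 <= s j x)%R) ->
  (forall j A, (j <= n)%N -> G j A ->
    \int[P]_(x in A) (s j x * v x)%:E <= \int[P]_(x in A) (k x)%:E) ->
  \int[P]_x (v x)%:E < +oo \/ \int[P]_x (k x)%:E < +oo ->
  \int[P]_x (runmax (s^~ x) n `^ q * v x)%:E <=
  \int[P]_x ((q / (q - 1)) `^ q * ((k x / v x) `^ q * v x))%:E.
Proof.
move=> ms s0 sk fin.
pose sL i j x := Order.min (s j x) i%:R.
have bnd i : \int[P]_x (runmax ((sL i)^~ x) n `^ q * v x)%:E <=
  \int[P]_x ((q / (q - 1)) `^ q * ((k x / v x) `^ q * v x))%:E.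
  apply: (@doob_bounded _ _ i%:R) => //.
  - by move=> j; apply: measurable_minr.
  - by move=> j x; rewrite le_min s0 ler0n.
  - move=> j A jn GA; apply: le_trans (sk _ _ jn GA).
    have mA := sub_sigma_measurable (sG j) GA.
    have ms' := sub_sigma_measurable_fun (sG j) (ms j).
    apply: ge0_le_integral => //.
    + by move=> x _; rewrite lee_fin mulr_ge0// le_min s0 ler0n.
    + apply/measurable_EFinP/measurable_funTS/measurable_funM => //.
      exact: measurable_minr.
    + exact/measurable_EFinP/measurable_funTS/measurable_funM.
    + by move=> x _; rewrite lee_fin ler_wpM2r// ge_min lexx.
  - by move=> j x; rewrite ge_min lexx orbT.
pose m x := runmax (s^~ x) n.
have mm : measurable_fun [set: T] m.
  exact: sub_sigma_measurable_fun (sG n) (measurable_runmax_sub ms).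
have m0 x : (0 <= m x)%R.
  by rewrite (le_trans (s0 0%N x))// (@runmax_ub _ _ (s^~ x)).
have sLE i x : runmax ((sL i)^~ x) n = Order.min (m x) i%:R by rewrite runmax_min.
have nd x : nondecreasing_seq (fun i => (Order.min (m x) i%:R `^ q * v x)%:E).
  move=> i j ij; rewrite lee_fin ler_wpM2r// ge0_ler_powR ?nnegrE ?le_min ?m0 ?ler0n//.
  - by rewrite ltW// (lt_trans _ q1).
  - by rewrite !ge_min ?lexx ler_nat ij !orbT.
rewrite [leLHS](_ : _ = \int[P]_x
    limn (fun i => (Order.min (m x) i%:R `^ q * v x)%:E)); last first.
  apply: eq_integral => x _; apply/esym/cvg_lim => //.
  apply: cvg_near_cst; exists (Num.truncn (m x)).+1 => // i /= mi.
  congr ((_ `^ _ * _)%:E); apply/min_idPl.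
  by rewrite (le_trans (ltW (truncnS_gt _)))// ler_nat.
rewrite monotone_convergence//; last 2 first.
- move=> i; apply/measurable_EFinP/measurable_funM => //.
  by apply: measurable_fun_powR; exact: measurable_minr.
- by move=> i x _; rewrite lee_fin mulr_ge0// powR_ge0.
apply: lime_le.
  apply: ereal_nondecreasing_is_cvgn => i j ij; apply: ge0_le_integral => //.
  - by move=> x _; rewrite lee_fin mulr_ge0// powR_ge0.
  - apply/measurable_EFinP/measurable_funM => //.
    by apply: measurable_fun_powR; exact: measurable_minr.
  - apply/measurable_EFinP/measurable_funM => //.
    by apply: measurable_fun_powR; exact: measurable_minr.
  - by move=> x _; exact: nd.
apply: nearW => i; apply: le_trans (bnd i).
by under [leRHS]eq_integral do rewrite sLE.
Qed.

End doob.

(** * Conditional expectation *)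

Section conditional_expectation.
Local Open Scope ereal_scope.
Context {R : realType} {d : measure_display} {T : measurableType d}.
Variables (P : probability T R) (G : set (set T)).
Hypothesis sG : sub_sigma G.

Let mid : measurable_fun [set: T] (id : T -> g_sigma_algebraType G).
Proof. by move=> _ B; rewrite setTI (sub_sigmaE sG); exact: sub_sigma_measurable. Qed.

(** The law of the identity from [T] to its copy carrying [G] is the restriction of [P] to [G]. *)
Let idG : {mfun T >-> g_sigma_algebraType G} :=
  HB.pack (id : T -> g_sigma_algebraType G) (isMeasurableFun.Build _ _ _ _ _ mid).

Section density.
Variable f : T -> R.
Hypotheses (mf : measurable_fun setT f) (f0 : forall x, (0 <= f x)%R).
Hypothesis f_fin : \int[P]_x (f x)%:E < +oo.

Let nu (A : set (g_sigma_algebraType G)) : \bar R :=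
  \int[P]_(x in (A : set T)) (f x)%:E.

Let nu0 : nu set0 = 0. Proof. by rewrite /nu integral_set0. Qed.

Let nu_ge0 A : 0 <= nu A.
Proof. by apply: integral_ge0 => x _; rewrite lee_fin. Qed.

Let nu_sigma_additive : semi_sigma_additive nu.
Proof.
move=> F mF tF mUF.
apply: (@semi_sigma_additive_nng_induced _ _ _ P (EFin \o f)) => //.
- exact/measurable_EFinP.
- by move=> n; apply: (sub_sigma_measurable sG); rewrite -(sub_sigmaE sG).
- by apply: (sub_sigma_measurable sG); rewrite -(sub_sigmaE sG).
Qed.

HB.instance Definition _ := isMeasure.Build _ _ _ nu nu0 nu_ge0 nu_sigma_additive.

Let nu_fin : fin_num_fun nu.
Proof.
move=> A mA; rewrite ge0_fin_numE//; apply: le_lt_trans f_fin.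
apply: ge0_subset_integral => //.
- by apply: (sub_sigma_measurable sG); rewrite -(sub_sigmaE sG).
- exact/measurable_EFinP.
- by move=> x _; rewrite lee_fin.
Qed.

HB.instance Definition _ := Measure_isFinite.Build _ _ _ nu nu_fin.

(** The conditional expectation is the Radon-Nikodym derivative of [f dP] with respect to [P], both
    restricted to [G]. *)
Lemma cond_exp_finite : exists g : T -> \bar R,
  [/\ measurable_fun [set: g_sigma_algebraType G] g, (forall x, 0 <= g x) &
  forall A, G A -> \int[P]_(x in A) g x = \int[P]_(x in A) (f x)%:E].
Proof.
have numu : nu `<< distribution P idG.
  apply/null_content_dominatesP => A mA PA0.
  have mA' : measurable (A : set T).
    by apply: (sub_sigma_measurable sG); rewrite -(sub_sigmaE sG).
  apply: null_set_integral => //.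
  exact/measurable_EFinP/measurable_funTS.
have [g [g0 _ intg gE]] := radon_nikodym_sigma_finite numu.
have mg := measurable_int _ intg.
exists g; split=> // A GA.
have mA : measurable (A : set (g_sigma_algebraType G)) by rewrite (sub_sigmaE sG).
rewrite -[RHS]/(nu A) gE// [RHS]ge0_integral_pushforward//.
exact: measurable_funTS.
Qed.

End density.

(** Integrability of [f] is avoided by conditioning its truncations. Their chosen versions [g n]
    increase only almost everywhere, so the running maxima are used instead: these increase
    everywhere, and [integral_lim_runmax_le] still bounds their limit by [f]. *)
Lemma cond_exp_exists (f : T -> R) :
  measurable_fun setT f -> (forall x, (0 <= f x)%R) ->
  exists g : T -> \bar R,
  [/\ measurable_fun [set: g_sigma_algebraType G] g, (forall x, 0 <= g x) &
  forall A, G A -> \int[P]_(x in A) g x = \int[P]_(x in A) (f x)%:E].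
Proof.
move=> mf f0.
pose fn n x := Order.min (f x) n%:R.
have mfn n : measurable_fun setT (fn n) by exact: measurable_minr.
have fn0 n x : (0 <= fn n x)%R by rewrite le_min f0 ler0n.
have fn_fin n : \int[P]_x (fn n x)%:E < +oo.
  apply: (@le_lt_trans _ _ (\int[P]_x (cst n%:R%:E x))).
    apply: ge0_le_integral => //.
    - by move=> x _; rewrite lee_fin.
    - exact/measurable_EFinP.
    - by move=> x _; rewrite lee_fin ge_min lexx orbT.
  rewrite integral_cst//.
  rewrite lte_mul_pinfty ?lee_fin//.
  exact: (le_lt_trans (probability_le1 P measurableT) (ltry 1)).
have /choice[g gP] := fun n => cond_exp_finite (mfn n) (fn0 n) (fn_fin n).
have mg n : measurable_fun [set: g_sigma_algebraType G] (g n) by case: (gP n).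
have g0 n x : 0 <= g n x by case: (gP n).
have gE n A : G A -> \int[P]_(x in A) g n x = \int[P]_(x in A) (fn n x)%:E.
  by case: (gP n) => _ _; exact.
have gf n A : G A -> \int[P]_(x in A) g n x <= \int[P]_(x in A) (f x)%:E.
  move=> GA; rewrite gE//; have mA := sub_sigma_measurable sG GA.
  apply: ge0_le_integral => //.
  - by move=> x _; rewrite lee_fin.
  - exact/measurable_EFinP/measurable_funTS.
  - exact/measurable_EFinP/measurable_funTS.
  - by move=> x _; rewrite lee_fin ge_min lexx.
have nd x : nondecreasing_seq (runmax (g^~ x)).
  by apply/nondecreasing_seqP => n; exact: runmaxS.
pose h x := limn (runmax (g^~ x)).
have mh : measurable_fun [set: g_sigma_algebraType G] (h : T -> \bar R).
  apply: (@emeasurable_fun_cvg _ (g_sigma_algebraType G) _ setT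
    (fun n (x : T) => runmax (g^~ x) n)) => //.
    by move=> n; exact: emeasurable_runmax.
  by move=> x _; exact: ereal_nondecreasing_is_cvgn.
have gh n x : g n x <= h x.
  rewrite (le_trans (@runmax_ub _ _ (g^~ x) n n (leqnn n)))//.
  apply: lime_ge; first exact: ereal_nondecreasing_is_cvgn.
  by exists n => // m /= nm; exact: nd.
exists h; split=> //; first by move=> x; rewrite (le_trans (g0 0%N x)).
move=> A GA; have mA := sub_sigma_measurable sG GA.
apply/eqP; rewrite eq_le; apply/andP; split.
  apply: (integral_lim_runmax_le sG) => //; first exact/measurable_EFinP.
have -> : \int[P]_(x in A) (f x)%:E = \int[P]_(x in A) limn (fun n => (fn n x)%:E).
  apply: eq_integral => x _; apply/esym/cvg_lim => //.
  apply: cvg_near_cst; exists (Num.truncn (f x)).+1 => // i /= mi.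
  congr (_%:E); apply/min_idPl.
  by rewrite (le_trans (ltW (truncnS_gt _)))// ler_nat.
have ndf x : nondecreasing_seq (fun n => (fn n x)%:E).
  move=> i j ij; rewrite lee_fin le_min ge_min lexx/= ge_min ler_nat ij orbT//.
rewrite monotone_convergence//.
- apply: lime_le.
    apply: ereal_nondecreasing_is_cvgn => i j ij; apply: ge0_le_integral => //.
    + by move=> x _; rewrite lee_fin.
    + exact/measurable_EFinP/measurable_funTS.
    + exact/measurable_EFinP/measurable_funTS.
    + by move=> x _; exact: ndf.
  apply: nearW => n; rewrite -gE//; apply: ge0_le_integral => //.
  + exact/measurable_funTS/(sub_sigma_measurable_fun sG).
  + exact/measurable_funTS/(sub_sigma_measurable_fun sG).
- by move=> n; exact/measurable_EFinP/measurable_funTS.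
- by move=> n x _; rewrite lee_fin.
Qed.

End conditional_expectation.

(** * Hilbert-space valued martingales *)

Section inner_product.
Context {R : realType} {V : normedModType R}.
Variable ip : V -> V -> R.
Hypothesis ipP : is_inner_product ip.

Let ipC x y : ip x y = ip y x. Proof. by case: ipP => + _; exact. Qed.

Let ipDl a x y z : ip (a *: x + y) z = a * ip x z + ip y z.
Proof. by case: ipP => _ [+ _]; exact. Qed.

Let ipxx x : ip x x = `|x| ^+ 2.
Proof. by case: ipP => _ [_]; exact. Qed.

Let ipBl x y z : ip (x - y) z = ip x z - ip y z.
Proof. by rewrite addrC -scaleN1r ipDl mulN1r addrC. Qed.

Let ip0l z : ip 0 z = 0.
Proof. by rewrite -(subrr 0) ipBl subrr. Qed.

Let ipZl a x z : ip (a *: x) z = a * ip x z.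
Proof. by rewrite -[a *: x]addr0 ipDl ip0l addr0. Qed.

Let ipZr a x z : ip x (a *: z) = a * ip x z.
Proof. by rewrite ipC ipZl ipC. Qed.

Let ipBr x y z : ip x (y - z) = ip x y - ip x z.
Proof. by rewrite ipC ipBl ipC [ip z x]ipC. Qed.

Lemma cauchy_schwarz x y : `|ip x y| <= `|x| * `|y|.
Proof.
have [->|y0] := eqVneq y 0; first by rewrite ipC ip0l !normr0 mulr0.
have ny : 0 < `|y| by rewrite normr_gt0.
(* This vector is the component of [x] orthogonal to [y], scaled by [|y|^2] to avoid division. *)
have : 0 <= ip (`|y| ^+ 2 *: x - ip x y *: y) (`|y| ^+ 2 *: x - ip x y *: y).
  by rewrite ipxx sqr_ge0.
rewrite ipBl !ipBr !(ipZl, ipZr) !ipxx [ip y x]ipC.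
rewrite (_ : _ - _ = `|y| ^+ 2 * ((`|x| * `|y|) ^+ 2 - ip x y ^+ 2)); last by ring.
rewrite pmulr_rge0 ?exprn_gt0// subr_ge0 -[ip x y ^+ 2]ger0_norm ?sqr_ge0// normrX => h.
by rewrite -(@ler_pXn2r _ 2) ?nnegrE ?mulr_ge0.
Qed.

Lemma ip_continuous h : continuous (ip^~ h).
Proof.
move=> x; apply/cvgrPdist_le => e e0; near=> y.
rewrite -ipBl (le_trans (cauchy_schwarz _ _))//.
have hp : 0 < `|h| + 1 by rewrite ltr_wpDl.
apply: (@le_trans _ _ (`|x - y| * (`|h| + 1))).
  by rewrite ler_wpM2l// lerDl.
rewrite -ler_pdivlMr//; near: y.
by apply: cvgr_dist_le; [exact: cvg_id|rewrite divr_gt0].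
Unshelve. all: by end_near. Qed.

(** Normalise a countable dense set: if [z] is within [e/2] of [x], pairing [x] with [z / |z|] gives
    at least [|z| - e/2], hence at least [|x| - e]. *)
Lemma separable_norming : separable_space V ->
  exists h : nat -> V, (forall j, `|h j| <= 1) /\
    forall x e, 0 < e -> exists j, `|x| - e <= ip x (h j).
Proof.
move=> [D [/countable_injP[f finj] clD]].
(* [y] inverts the injection [f] of [D] into the naturals, with value 0 off its range. *)
pose y j := xget 0 [set z | D z /\ f z = j].
exists (fun j => `|y j|^-1 *: y j); split=> [j|x e e0].
  rewrite normrZ normfV normr_id; have [->|y0] := eqVneq (y j) 0.
    by rewrite normr0 mulr0.
  by rewrite mulVf// normr_eq0.
have : closure D x by rewrite clD.
move=> /(_ (ball x (e / 2))) [|z [Dz xz]].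
  by apply: nbhsx_ballx; rewrite divr_gt0.
have yz : y (f z) = z.
  have [Dy fy] : D (y (f z)) /\ f (y (f z)) = f z.
    by apply: (@xgetPex _ 0 [set w | D w /\ f w = f z]); exists z.
  by apply: finj; rewrite ?inE.
exists (f z); rewrite yz ipZr.
have {xz} xz : `|x - z| < e / 2 by move: xz; rewrite -ball_normE.
have xzn : `|x| <= `|x - z| + `|z| by rewrite -{1}(subrK z x) ler_normD.
have [z0|z0] := eqVneq z 0.
  by move: xzn; rewrite z0 normr0 invr0 mul0r -z0; lra.
have nz : 0 < `|z| by rewrite normr_gt0.
have -> : ip x z = `|z| ^+ 2 + ip (x - z) z by rewrite ipBl ipxx; ring.
have := cauchy_schwarz (x - z) z; rewrite ler_norml => /andP[cs _].
rewrite [leRHS]mulrC ler_pdivlMr// expr2.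
have : `|x - z| * `|z| <= e / 2 * `|z| by rewrite ler_wpM2r// ltW.
have : (`|x| - e) * `|z| <= (`|z| - e / 2) * `|z| by rewrite ler_wpM2r// ; lra.
by rewrite !mulrBl; move: cs; lra.
Qed.

End inner_product.

Section martingale_norm.
Local Open Scope ereal_scope.
Context {R : realType} {d : measure_display} {T : measurableType d}.
Context {V : normedModType R}.
Variables (P : {measure set T -> \bar R}) (ip : V -> V -> R).
Hypothesis ipP : is_inner_product ip.

Lemma meas_in_comp (U W : topologicalType) (G : set (set T)) (f : T -> U)
  (g : U -> W) : continuous g -> meas_in G f -> meas_in G (g \o f).
Proof. by move=> /continuousP cg mf O oO; rewrite comp_preimage; exact/mf/cg. Qed.

(* Duality: the norm of [X] is a countable supremum of the functions
   [ip X h_j], each of which is dominated through the martingale identity. *)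
Lemma integral_norm_cond_le (G H : set (set T)) (X Y : T -> V) :
  sub_sigma G -> sub_sigma H -> separable_space V ->
  meas_in G X -> meas_in H Y ->
  (forall h A, G A ->
    \int[P]_(x in A) (ip (Y x) h)%:E = \int[P]_(x in A) (ip (X x) h)%:E) ->
  forall A, G A ->
  \int[P]_(x in A) (`|X x|)%:E <= \int[P]_(x in A) (`|Y x|)%:E.
Proof.
move=> sG sH sepV mX mY XY A GA.
have mA := sub_sigma_measurable sG GA.
have [h [h1 hn]] := separable_norming ipP sepV.
have mXh j : measurable_fun [set: g_sigma_algebraType G] (fun x => ip (X x) (h j)).
  apply: meas_in_measurable_fun => //.
  by apply: (meas_in_comp (g := ip^~ (h j))) => //; exact: ip_continuous.
have mYh j : measurable_fun [set: T] (fun x => ip (Y x) (h j)).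
  apply: (sub_sigma_measurable_fun sH); apply: meas_in_measurable_fun => //.
  by apply: (meas_in_comp (g := ip^~ (h j))) => //; exact: ip_continuous.
have mnY : measurable_fun [set: T] (fun x => `|Y x|%R).
  apply: (sub_sigma_measurable_fun sH); apply: meas_in_measurable_fun => //.
  by apply: (meas_in_comp (g := @Num.norm _ V)) => //; exact: norm_continuous.
have iph x j : (`|ip x (h j)| <= `|x|)%R.
  rewrite (le_trans (cauchy_schwarz ipP _ _))//.
  by rewrite ler_piMr.
(* Positive parts make the family nonnegative and leave its supremum, the norm, unchanged. *)
pose f j x := (Order.max 0 (ip (X x) (h j)))%:E.
have f0 j x : 0 <= f j x by rewrite lee_fin le_max lexx.
have mf j : measurable_fun [set: g_sigma_algebraType G] (f j).
  by apply/measurable_EFinP; apply: measurable_maxr.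
have nd x : nondecreasing_seq (runmax (f^~ x)).
  by apply/nondecreasing_seqP => n; exact: runmaxS.
rewrite (eq_integral (fun x => limn (runmax (f^~ x)))); last first.
  move=> x _; apply/eqP; rewrite eq_le; apply/andP; split.
    apply/lee_addgt0Pr => e e0; have [j hj] := hn (X x) e e0.
    rewrite -leeBlDr// -EFinB (@le_trans _ _ (f j x))//.
      by rewrite lee_fin le_max hj orbT.
    apply: lime_ge; first exact: ereal_nondecreasing_is_cvgn.
    by exists j => // m /= jm; exact: (@runmax_ub _ _ (f^~ x)).
  apply: lime_le; first exact: ereal_nondecreasing_is_cvgn.
  apply: nearW => n; apply: runmax_le => j _.
  by rewrite lee_fin ge_max normr_ge0 (le_trans (ler_norm _)).
apply: (integral_lim_runmax_le sG) => //; last first.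
- exact/measurable_EFinP.
(* The positive part is integrated over [C], an event of [G], so the identity replaces [X] by [Y]
   there before absolute values are taken. *)
move=> j B GB; pose C := [set x | 0 <= (ip (X x) (h j))%:E].
have GC : G C.
  by apply: sub_sigma_lee => //; exact/measurable_EFinP.
have GBC := sub_sigmaI sG GB GC.
have mB := sub_sigma_measurable sG GB.
have mBC := sub_sigma_measurable sG GBC.
apply: (@le_trans _ _ (\int[P]_(x in B `&` C) (ip (X x) (h j))%:E)).
  rewrite integral_mkcondr le_eqVlt; apply/orP; left; apply/eqP.
  apply: eq_integral => x _; rewrite patchE /f; case: ifPn => xC.
    by congr EFin; apply/max_idPr; move: xC; rewrite inE /C/= lee_fin.
  congr EFin; apply/max_idPl; rewrite leNgt; apply: contra xC => /ltW.
  by rewrite inE /C/= lee_fin.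
rewrite -XY//; apply: (@le_trans _ _ (\int[P]_(x in B `&` C) (`|Y x|)%:E)).
  apply: le_trans (lee_abs _) _.
  apply: le_trans (le_abse_integral _ _ _) _ => //.
    exact/measurable_EFinP/measurable_funTS.
  apply: ge0_le_integral => //.
  - by apply/measurable_EFinP/measurable_funTS; exact: measurableT_comp.
  - exact/measurable_EFinP/measurable_funTS.
  - by move=> x _; rewrite lee_fin.
apply: ge0_subset_integral => //.
exact/measurable_EFinP/measurable_funTS.
Qed.

End martingale_norm.

(** * The A_p condition *)

Section filtration.
Context {R : realType} {d : measure_display} {T : measurableType d}.
Variable F : R -> set (set T).
Hypothesis filF : is_filtration F.

Lemma filtration_sub_sigma t : 0 <= t -> sub_sigma (F t).
Proof. by case: filF => h _ /h. Qed.

Lemma F_inf_sub_sigma : sub_sigma (F_inf F).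
Proof.
split; first exact: smallest_sigma_algebra.
apply: smallest_sub; first exact: sigma_algebra_measurable.
by move=> A [t t0 FtA]; case: filF => h _; case: (h t t0) => _; exact.
Qed.

Lemma F_inf_ub t : 0 <= t -> F t `<=` F_inf F.
Proof. by move=> t0 A FtA; apply: sub_sigma_algebra; exists t. Qed.

Lemma F_tau_cst t : 0 <= t -> F_tau F (fun=> t%:E) = F t.
Proof.
move=> t0; apply/seteqP; split => [A [_ /(_ t t0)]|A FtA].
  rewrite (_ : [set _ | _] = setT) ?setIT//.
  by apply/seteqP; split => // x _ /=.
split=> [|s s0]; first exact: F_inf_ub FtA.
have sF := filtration_sub_sigma s0.
have [ts|st] := leP t s.
  rewrite (_ : [set _ | _] = setT) ?setIT; last first.
    by apply/seteqP; split => // x _ /=; rewrite lee_fin.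
  by case: filF => _; apply; last exact: FtA.
rewrite (_ : [set _ | _] = set0) ?setI0; last first.
  by apply/seteqP; split => // x /=; rewrite lee_fin leNgt st.
by rewrite -(sub_sigmaE sF).
Qed.

Lemma stopping_time_cst t : 0 <= t -> stopping_time F (fun=> t%:E).
Proof.
move=> t0; split=> [x|s s0]; first by rewrite lee_fin.
have sF := filtration_sub_sigma s0.
have [ts|st] := leP t s.
  rewrite (_ : [set _ | _] = setT); first exact: sub_sigmaT.
  by apply/seteqP; split => // x _ /=; rewrite lee_fin.
rewrite (_ : [set _ | _] = set0); first by rewrite -(sub_sigmaE sF).
by apply/seteqP; split => // x /=; rewrite lee_fin leNgt st.
Qed.

End filtration.

Section Ap_weight.
Context {R : realType} {d : measure_display} {T : measurableType d}.
Variables (P : probability T R) (F : R -> set (set T)).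
Hypothesis filF : is_filtration F.
Variables (wt : R -> T -> R) (w : T -> R) (p : R).
Hypotheses (p1 : 1 < p) (wP : weight P F wt w).

Definition dual_weight x := w x `^ (- (p - 1)^-1).

Lemma weight_gt0 x : 0 < w x. Proof. by case: wP => _ []. Qed.

Lemma dual_weight_gt0 x : 0 < dual_weight x.
Proof. exact/powR_gt0/weight_gt0. Qed.

Lemma measurable_weight : measurable_fun setT w.
Proof.
case: wP => _ [_ [_ [_ [mw _]]]].
apply: (sub_sigma_measurable_fun (F_inf_sub_sigma filF)).
by apply: meas_in_measurable_fun => //; exact: F_inf_sub_sigma.
Qed.

Lemma measurable_dual_weight : measurable_fun setT dual_weight.
Proof. exact/measurable_fun_powR/measurable_weight. Qed.

Local Open Scope ereal_scope.

Lemma integral_weight_fin : \int[P]_x (w x)%:E < +oo.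
Proof.
case: wP => _ [_ [_ [_ [_ [/integrableP[_ wfin] _]]]]].
apply: le_lt_trans wfin; rewrite le_eqVlt; apply/orP; left; apply/eqP.
by apply: eq_integral => x _; rewrite /= normr_id gtr0_norm// weight_gt0.
Qed.

Lemma weight_cond t A : (0 <= t)%R -> F t A ->
  \int[P]_(x in A) (w x)%:E = \int[P]_(x in A) (wt t x)%:E.
Proof.
case: wP => _ [_ [_ [_ [_ [_ cw]]]]] t0 FA.
have := cw t t0 1%R A FA; rewrite /R_ip.
by under eq_integral do rewrite mulr1; under [RHS]eq_integral do rewrite mulr1.
Qed.

Lemma measurable_wt t : (0 <= t)%R ->
  measurable_fun [set: g_sigma_algebraType (F t)] (wt t).
Proof.
case: wP => _ [_ [[mw _] _]] t0; apply: meas_in_measurable_fun; last exact: mw.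
exact: filtration_sub_sigma.
Qed.

(* Deterministic stopping times suffice for the whole proof. *)
Lemma Ap_density t : (0 <= t)%R -> Qp P F p w < +oo ->
  exists ut : T -> \bar R,
  [/\ measurable_fun [set: g_sigma_algebraType (F t)] ut, (forall x, 0 <= ut x),
      forall A, F t A ->
        \int[P]_(x in A) ut x = \int[P]_(x in A) (dual_weight x)%:E,
      {ae P, forall x, 0 < ut x < +oo} &
      {ae P, forall x, (wt t x)%:E * poweR (ut x) (p - 1) <= Qp P F p w}].
Proof.
move=> t0 Qoo; have sF := filtration_sub_sigma filF t0.
have mu := measurable_dual_weight.
have u0 x : (0 <= dual_weight x)%R by exact/ltW/dual_weight_gt0.
have [ut [mut ut0 utE]] := cond_exp_exists P sF mu u0.
have w0 x : (0 < wt t x)%R by case: wP => + _; apply.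
have aeQ : {ae P, forall x, (wt t x)%:E * poweR (ut x) (p - 1) <= Qp P F p w}.
  apply/ess_supP; apply: ereal_sup_ubound.
  (* [Qp] ranges over all versions of the conditional expectations, so [wt t] itself may be used. *)
  exists (fun=> t%:E), (fun x => (wt t x)%:E), ut; split => //.
  - exact: stopping_time_cst.
  - rewrite F_tau_cst//; split.
      apply: measurable_fun_meas_in => //; apply/measurable_EFinP.
      exact: measurable_wt.
    split; first by move=> x; rewrite lee_fin ltW.
    by move=> A FA; rewrite (weight_cond t0).
  - rewrite F_tau_cst//; split => //.
    exact: measurable_fun_meas_in.
exists ut; split => //.
(* The integral of [u] over this event equals that of [ut], which is 0; as [u] is positive, the
   event is null. *)
pose N := [set x | ut x <= 0].
have FN : F t N by apply: sub_sigma_lee => //; exact: measurable_cst.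
have mN := sub_sigma_measurable sF FN.
have aeN : ae_eq P N (EFin \o dual_weight) (cst 0).
  apply/ae_eq_integral_abs => //.
    exact/measurable_EFinP/measurable_funTS.
  under eq_integral do rewrite /= ger0_norm//.
  rewrite -utE//; apply: integral0_eq => x Nx.
  by apply/eqP; rewrite eq_le ut0 andbT.
near=> x; apply/andP; split.
  rewrite ltNge; apply/negP => Nx.
  have : N x -> (EFin \o dual_weight) x = 0 by near: x.
  by move=> /(_ Nx) [] ux; have := dual_weight_gt0 x; rewrite ux ltxx.
rewrite ltey; apply/eqP => utoo.
have : (wt t x)%:E * poweR (ut x) (p - 1) <= Qp P F p w by near: x.
(* An infinite [ut x] would make the product infinite, since [wt t x] is positive. *)
rewrite utoo poweRyr; last by rewrite lt0r_neq0// subr_gt0.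
by rewrite gt0_muley ?lte_fin// leye_eq => /eqP Qy; rewrite Qy ltxx in Qoo.
Unshelve. all: by end_near. Qed.

(** A negative value would bound a nonnegative function almost everywhere, which is absurd for a
    probability. Together with finiteness it makes [fine (Qp P F p w)] a faithful real value. *)
Lemma Qp_ge0 : Qp P F p w < +oo -> 0 <= Qp P F p w.
Proof.
move=> Qoo; have [ut [_ ut0 _ _ aeQ]] := Ap_density (lexx 0%R) Qoo.
rewrite leNgt; apply/negP => Q0.
have : {ae P, forall x : T, False}.
  near=> x; have : (wt 0 x)%:E * poweR (ut x) (p - 1) <= Qp P F p w by near: x.
  apply/negP; rewrite -ltNge (lt_le_trans Q0)// mule_ge0 ?poweR_ge0// lee_fin.
  by apply: ltW; case: wP => + _; apply.
move=> [N [mN N0 TN]].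
have NT : N = setT by apply/seteqP; split => // x _; exact: TN.
have PT : P setT = 1 := probability_setT P.
by move: N0; rewrite NT PT => -[] /eqP; rewrite oner_eq0.
Unshelve. all: by end_near. Qed.

End Ap_weight.

Lemma runmax_homo (R : realType) (phi : R -> R) (f : nat -> R) n :
  (forall j, 0 <= f j) -> {in Num.nneg &, {homo phi : x y / x <= y}} ->
  runmax (phi \o f) n = phi (runmax f n).
Proof.
move=> f0 phi_nd; elim: n => //= n ->.
have m0 : 0 <= runmax f n by rewrite (le_trans (f0 0%N))// runmax_ub.
case: (leP (runmax f n) (f n.+1)) => h.
  by apply/max_idPr; apply: phi_nd => //; rewrite nnegrE.
by apply/max_idPl; apply: phi_nd; rewrite ?nnegrE// ltW.
Qed.

(** * The weighted maximal inequality along finitely many times *)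

Section discrete_maximal_inequality.
Local Open Scope ereal_scope.
Context {R : realType} {d : measure_display} {T : measurableType d}.
Variables (P : probability T R) (F : R -> set (set T)).
Hypothesis filF : is_filtration F.
Context {V : normedModType R}.
Variables (ip : V -> V -> R) (X : R -> T -> V) (Xinf : T -> V).
Hypotheses (ipP : is_inner_product ip) (sepV : separable_space V).
Hypotheses (mX : H_martingale P ip F X) (cX : H_closure P ip F X Xinf).
Variables (wt : R -> T -> R) (w : T -> R) (p : R).
Hypotheses (p1 : (1 < p)%R) (wP : weight P F wt w).
Hypothesis Qoo : Qp P F p w < +oo.

Lemma discrete_maximal_inequality (tm : nat -> R) N :
  (forall j, (0 <= tm j)%R) -> {homo tm : i j / (i <= j)%N >-> (i <= j)%R} ->
  \int[P]_x (runmax (fun j => `|X (tm j) x|%R) N `^ p * w x)%:E <=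
  ((p `^ (p / (p - 1)) / (p - 1) * fine (Qp P F p w) `^ (p - 1)^-1) `^ p)%:E *
  \int[P]_x (`|Xinf x| `^ p * w x)%:E.
Proof.
move=> tm0 tm_nd.
have p1' := p1; have p0 : (0 < p)%R by lra.
have pB0 : (0 < p - 1)%R by lra.
have pBN0 : (p - 1 != 0)%R by exact: lt0r_neq0.
have pN0 : (p != 0)%R by exact: lt0r_neq0.
pose q := (p / (p - 1))%R.
have q1 : (1 < q)%R by rewrite /q ltr_pdivlMr//; lra.
have qE : (q / (q - 1) = p)%R.
  by rewrite /q; field; rewrite ?pBN0/=; apply: lt0r_neq0; lra.
have pq : ((p - 1) * q = p)%R by rewrite /q; field.
pose u := dual_weight w p.
have u0 x : (0 < u x)%R := dual_weight_gt0 p wP x.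
have w0 x : (0 < w x)%R := weight_gt0 wP x.
have mu : measurable_fun setT u := measurable_dual_weight filF p wP.
have mw : measurable_fun setT w := measurable_weight filF wP.
pose Q := fine (Qp P F p w).
have Q0 : (0 <= Q)%R by rewrite fine_ge0// (Qp_ge0 filF p1 wP).
have QE : Qp P F p w = Q%:E.
  by rewrite fineK// ge0_fin_numE// (Qp_ge0 filF p1 wP).
have sF j : sub_sigma (F (tm j)) by exact: filtration_sub_sigma.
have ndF i j : (i <= j)%N -> F (tm i) `<=` F (tm j).
  by move=> ij; case: filF => _; apply => //; exact: tm_nd.
have sFi := F_inf_sub_sigma filF.
have mnX j : measurable_fun [set: g_sigma_algebraType (F (tm j))]
    (fun x => `|X (tm j) x|%R).
  apply: meas_in_measurable_fun => //.
  apply: (meas_in_comp (g := @Num.norm _ V)); first exact: norm_continuous.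
  by case: mX => + _; apply.
have mnXinf : measurable_fun setT (fun x => `|Xinf x|%R).
  apply: (sub_sigma_measurable_fun sFi); apply: meas_in_measurable_fun => //.
  apply: (meas_in_comp (g := @Num.norm _ V)); first exact: norm_continuous.
  by case: cX.
have X_le j A : F (tm j) A ->
    \int[P]_(x in A) (`|X (tm j) x|%R)%:E <= \int[P]_(x in A) (`|Xinf x|%R)%:E.
  apply: (integral_norm_cond_le ipP (sF j) sFi sepV).
  - by case: mX => + _; apply.
  - by case: cX.
  - by case: cX => _ [_ cXt] h B FB; exact: cXt.
have /choice[ut utP] := fun j => Ap_density filF p1 wP (tm0 j) Qoo.
have mut j : measurable_fun [set: g_sigma_algebraType (F (tm j))] (ut j).
  by case: (utP j).
have ut0 j x : 0 <= ut j x by case: (utP j).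
(* Junk values: [s j x = 0] wherever [ut j x] is [0] or [+oo]. *)
pose s j x := (`|X (tm j) x| * (fine (ut j x))^-1)%R.
have s0 j x : (0 <= s j x)%R by rewrite mulr_ge0// invr_ge0 fine_ge0.
have ms j : measurable_fun [set: g_sigma_algebraType (F (tm j))] (s j).
  apply: measurable_funM => //; apply: measurable_fun_inv.
    exact: (measurableT_comp (fine_measurable _)).
  by move=> x; rewrite fine_ge0.
have ms' j := sub_sigma_measurable_fun (sF j) (ms j).
pose m x := runmax (s^~ x) N.
have mm : measurable_fun setT m.
  by apply: measurable_runmax => j _; exact: ms'.
have m0 x : (0 <= m x)%R.
  by rewrite (le_trans (s0 0%N x))// (@runmax_ub _ _ (s^~ x)).
have first_doob : \int[P]_x (m x `^ p * u x)%:E <=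
    \int[P]_x (q `^ p * (`|Xinf x| `^ p * w x))%:E.
  (* Duality of the weights: [u^(1-p) = w]. *)
  have uw x : ((`|Xinf x| / u x) `^ p * u x = `|Xinf x| `^ p * w x)%R.
    rewrite powRM ?invr_ge0// ?ltW// -mulrA; congr (_ * _)%R.
    rewrite -powR_inv1 ?ltW// -powRrM mulN1r.
    rewrite -{2}[u x]powRr1 ?ltW// -powRD; last by rewrite lt0r_neq0 ?implybT.
    rewrite /u /dual_weight -powRrM (_ : _ * _ = 1)%R ?powRr1 ?ltW//.
    by field.
  under [leRHS]eq_integral do rewrite -uw.
  apply: (weighted_doob sF ndF mu u0 mnXinf _ p1) => //.
  - move=> j A _ FA; apply: le_trans (X_le j A FA).
    have mA := sub_sigma_measurable (sF j) FA.
    (* Since [s j] is measurable at time [tm j], conditioning replaces [u] by [ut j]. *)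
    apply: (@le_trans _ _ (\int[P]_(x in A) ((s j x)%:E * ut j x))).
      under eq_integral do rewrite EFinM.
      apply: (integral_mul_le (sF j)) => //.
      + exact/measurable_EFinP.
      + by move=> x; rewrite lee_fin ltW.
      + exact: sub_sigma_measurable_fun (sF j) (mut j).
      + by case: (utP j) => _ _ utE _ _ B FB; rewrite utE.
      + exact/measurable_EFinP.
      + by move=> x; rewrite lee_fin.
    apply: ge0_le_integral => //.
    + by move=> x _; rewrite mule_ge0// lee_fin.
    + apply: measurable_funTS; apply: emeasurable_funM.
        exact/measurable_EFinP.
      exact: sub_sigma_measurable_fun (sF j) (mut j).
    + apply/measurable_funTS/measurable_EFinP.
      exact: sub_sigma_measurable_fun (sF j) (mnX j).
    (* The product is [|X|] at finite positive values of [ut j x] and 0 at the junk ones, by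
       [0 * +oo = 0]. *)
    + move=> x _; rewrite /s; move: (ut0 j x); case: (ut j x) => [r||]//=.
        rewrite -EFinM !lee_fin le_eqVlt => /predU1P[<-|r0].
          by rewrite mulr0.
        by rewrite mulfVK// lt0r_neq0.
      by rewrite invr0 mulr0 mul0e lee_fin.
  - right; case: cX => _ [/integrableP[_ fin] _].
    apply: le_lt_trans fin; rewrite le_eqVlt; apply/orP; left; apply/eqP.
    by apply: eq_integral => x _; rewrite /= normr_id.
have second_doob :
    \int[P]_x (runmax (fun j => `|X (tm j) x|%R) N `^ p * w x)%:E <=
    \int[P]_x (p `^ q * (Q `^ q * (m x `^ p * u x)))%:E.
  have Xm x : (runmax (fun j => `|X (tm j) x|%R) N `^ p =
      runmax (fun j => `|X (tm j) x| `^ (p - 1)) N `^ q)%R.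
    rewrite -[in LHS]pq powRrM; congr (_ `^ _)%R; apply/esym.
    apply: (@runmax_homo _ (fun y => y `^ (p - 1))%R) => // y z y0 z0 yz.
    by rewrite ge0_ler_powR// ltW.
  (* Dually to [uw], [w^(1-q) = u], because [1 - q = - 1 / (p - 1)]. *)
  have wu x : ((Q * m x `^ (p - 1) / w x) `^ q * w x =
      Q `^ q * (m x `^ p * u x))%R.
    rewrite !powRM ?mulr_ge0 ?invr_ge0 ?powR_ge0// ?ltW// -powRrM pq -!mulrA.
    congr (_ * (_ * _))%R; rewrite -powR_inv1 ?ltW// -powRrM mulN1r.
    rewrite -{2}[w x]powRr1 ?ltW// -powRD; last by rewrite lt0r_neq0 ?implybT.
    by rewrite /u /dual_weight /q; congr (_ `^ _)%R; field.
  under eq_integral do rewrite Xm.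
  under [leRHS]eq_integral do rewrite -wu -{1}qE.
  apply: (@weighted_doob _ _ _ P _ sF ndF w (fun x => Q * m x `^ (p - 1))%R q
    mw w0 _ _ q1 (fun j x => `|X (tm j) x| `^ (p - 1))%R) => //.
  - by apply: measurable_funM => //; exact: measurable_fun_powR.
  - by move=> x; rewrite mulr_ge0 ?powR_ge0.
  - by move=> j; exact: measurable_fun_powR.
  - move=> j A jN FA; have mA := sub_sigma_measurable (sF j) FA.
    have mwt := measurable_wt filF wP (tm0 j).
    have mwt' := sub_sigma_measurable_fun (sF j) mwt.
    have wt0 x : (0 <= wt (tm j) x)%R.
      by apply: ltW; case: wP => + _; apply.
    have mXp : measurable_fun [set: g_sigma_algebraType (F (tm j))]
      (fun x => `|X (tm j) x| `^ (p - 1))%R by exact: measurable_fun_powR.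
    have mXp' := sub_sigma_measurable_fun (sF j) mXp.
    apply: (@le_trans _ _ (\int[P]_(x in A)
        ((`|X (tm j) x| `^ (p - 1))%:E * (wt (tm j) x)%:E))).
      under eq_integral do rewrite EFinM.
      apply: (integral_mul_le (sF j)) => //.
      + exact/measurable_EFinP.
      + by move=> x; rewrite lee_fin ltW.
      + exact/measurable_EFinP.
      + by move=> B FB; rewrite (weight_cond wP (tm0 j) FB).
      + exact/measurable_EFinP.
    apply: ae_ge0_le_integral => //.
    + by move=> x _; rewrite mule_ge0// lee_fin ?powR_ge0.
    + by apply/measurable_funTS/emeasurable_funM; exact/measurable_EFinP.
    + by move=> x _; rewrite lee_fin mulr_ge0 ?powR_ge0.
    + apply/measurable_funTS/measurable_EFinP/measurable_funM => //.
      exact: measurable_fun_powR.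
    + near=> x => _.
      have : 0 < ut j x < +oo by near: x; case: (utP j).
      have : (wt (tm j) x)%:E * poweR (ut j x) (p - 1) <= Q%:E.
        by rewrite -QE; near: x; case: (utP j).
      have : (s j x <= m x)%R by exact: (@runmax_ub _ _ (s^~ x)).
      rewrite /s; case: (ut j x) => [r||]//=; last by rewrite ltxx andbF.
      move=> sm; rewrite -EFinM lee_fin => wQ /andP[]; rewrite lte_fin => r0 _.
      rewrite -EFinM lee_fin.
      have rp : (0 < r `^ (p - 1))%R by rewrite powR_gt0.
      (* Inserting [u_t] splits the product into the A_p quantity [w_t u_t^(p-1)], at most [Q], and
         [(|X_t| / u_t)^(p-1)], at most [m^(p-1)]. *)
      have -> : (`|X (tm j) x| `^ (p - 1) * wt (tm j) x =
          wt (tm j) x * r `^ (p - 1) * (`|X (tm j) x| * r^-1) `^ (p - 1))%R.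
        rewrite powRM ?invr_ge0// ?ltW// -powR_inv1 ?ltW// powRAC.
        rewrite powR_inv1 ?ltW//; field; exact: lt0r_neq0.
      rewrite ler_pM ?powR_ge0 ?mulr_ge0 ?powR_ge0//.
      apply: ge0_ler_powR => //; first exact: ltW.
        by rewrite nnegrE mulr_ge0// invr_ge0 ltW.
      by rewrite nnegrE.
  - left; exact: integral_weight_fin wP.
apply: (le_trans second_doob).
have mXw : measurable_fun setT (fun x => (`|Xinf x| `^ p * w x)%:E).
  by apply/measurable_EFinP/measurable_funM => //; exact: measurable_fun_powR.
have mmu : measurable_fun setT (fun x => (m x `^ p * u x)%:E).
  by apply/measurable_EFinP/measurable_funM => //; exact: measurable_fun_powR.
move: first_doob.
rewrite (_ : \int[P]_x (q `^ p * (`|Xinf x| `^ p * w x))%:E =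
    (q `^ p)%:E * \int[P]_x (`|Xinf x| `^ p * w x)%:E); last first.
  under eq_integral do rewrite EFinM.
  rewrite ge0_integralZl// ?lee_fin ?powR_ge0// => x _.
  by rewrite lee_fin mulr_ge0 ?powR_ge0 ?ltW.
rewrite (_ : \int[P]_x (p `^ q * (Q `^ q * (m x `^ p * u x)))%:E =
    (p `^ q * Q `^ q)%:E * \int[P]_x (m x `^ p * u x)%:E); last first.
  under eq_integral do rewrite mulrA EFinM.
  rewrite ge0_integralZl// ?lee_fin ?mulr_ge0 ?powR_ge0// => x _.
  by rewrite lee_fin mulr_ge0 ?powR_ge0 ?ltW.
move=> first_doob.
apply: (@le_trans _ _ ((p `^ q * Q `^ q)%:E *
    ((q `^ p)%:E * \int[P]_x (`|Xinf x| `^ p * w x)%:E))).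
  by rewrite lee_wpmul2l// lee_fin mulr_ge0 ?powR_ge0.
rewrite muleA -EFinM lee_wpmul2r//.
  by apply: integral_ge0 => x _; rewrite lee_fin mulr_ge0 ?powR_ge0 ?ltW.
rewrite lee_fin -/Q -/q le_eqVlt; apply/orP; left; apply/eqP.
have pV0 : (0 <= (p - 1)^-1)%R by rewrite invr_ge0 ltW.
rewrite [RHS]powRM ?powR_ge0 ?mulr_ge0 ?powR_ge0// [in RHS]powRM ?powR_ge0//.
rewrite -!powRrM (_ : (p - 1)^-1 * p = q)%R; last by rewrite /q mulrC.
rewrite {3}/q powRM ?(ltW p0)//.
(* Conjugacy of [p] and [q] merges the two Doob constants: [p^q p^p = p^(q p)]. *)
rewrite (_ : q * p = q + p)%R; last by rewrite /q; field.
rewrite powRD; last by rewrite (lt0r_neq0 p0) implybT.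
by ring.
Unshelve. all: by end_near. Qed.

End discrete_maximal_inequality.

(** * From grids to the maximal function *)

Section limn_einf_bounds.
Local Open Scope ereal_scope.
Context {R : realType}.
Implicit Types (u : nat -> \bar R) (c : \bar R).

Lemma limn_einf_le u c : (forall n, u n <= c) -> limn_einf u <= c.
Proof.
move=> uc; rewrite limn_einf_lim; apply: lime_le; first exact: is_cvg_einfs.
apply: nearW => n; apply: le_trans (uc n).
by apply: ereal_inf_lbound; exists n => /=.
Qed.

Lemma limn_einf_ge u c : (\forall n \near \oo, c <= u n) -> c <= limn_einf u.
Proof.
move=> [N _ uc]; rewrite limn_einf_lim; apply: lime_ge; first exact: is_cvg_einfs.
exists N => // n /= Nn; apply: le_ereal_inf_tmp => _ [k /= nk <-].
by apply: uc => /=; exact: leq_trans nk.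
Qed.

End limn_einf_bounds.

Lemma runmax_ex {disp : Order.disp_t} {U : orderType disp} (f : nat -> U) n :
  exists j, runmax f n = f j.
Proof.
elim: n => [|n [j fj]]; first by exists 0%N.
by case: (runmax_cases f n) => ->; [exists j|exists n.+1].
Qed.

Section maximal_function.
Context {R : realType} {d : measure_display} {T : measurableType d}.
Context {V : normedModType R}.
Variable X : R -> T -> V.
Hypothesis rcX : forall x t, 0 <= t -> X s x @[s --> t^'+] --> X t x.

Definition grid n j : R := j%:R / n.+1%:R.

(** With mesh [1/(n+1)], these [(n+1)^2] steps cover [[0, n+1]]: the mesh shrinks while the horizon
    grows. The grids are not nested, whence a lower limit and Fatou's lemma instead of monotone
    convergence. *)
Definition grid_max n x : R := runmax (fun j => `|X (grid n j) x|) (n.+1 ^ 2)%N.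

Lemma grid_ge0 n j : 0 <= grid n j.
Proof. by rewrite divr_ge0. Qed.

Lemma grid_max_ge0 n x : 0 <= grid_max n x.
Proof.
apply: (le_trans (normr_ge0 (X (grid n 0) x))).
exact: (@runmax_ub _ _ (fun j => `|X (grid n j) x|)).
Qed.

Lemma grid_max_le n x : ((grid_max n x)%:E <= maximal_fun X x)%E.
Proof.
rewrite /grid_max; have [j ->] := runmax_ex (fun j => `|X (grid n j) x|) (n.+1 ^ 2)%N.
by apply: ereal_sup_ubound; exists (grid n j) => //=; exact: grid_ge0.
Qed.

Lemma near_grid_max x t c : 0 <= t -> c < `|X t x| ->
  \forall n \near \oo, c <= grid_max n x.
Proof.
move=> t0 ct.
have : \forall s \near t^'+, c < `|X s x|.
  have : `|X s x| @[s --> t^'+] --> `|X t x| by apply: cvg_norm; exact: rcX.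
  by move=> /cvgr_gt; apply.
rewrite near_withinE => -[e /= e0 He].
near=> n.
have n0 : 0 < n.+1%:R :> R by rewrite ltr0n.
(* The first grid point strictly to the right of [t], at distance at most the mesh, where right
   continuity applies. *)
pose k := (Num.truncn (t * n.+1%:R)).+1.
have tn0 : 0 <= t * n.+1%:R by rewrite mulr_ge0.
have tk : t < grid n k by rewrite /grid ltr_pdivlMr// truncnS_gt.
have kt : grid n k <= t + n.+1%:R^-1.
  rewrite /grid ler_pdivrMr// mulrDl mulVf ?lt0r_neq0// /k -natr1 lerD2r.
  by have /andP[] := truncn_itv tn0.
have ne : n.+1%:R^-1 < e by near: n; exact: (near_infty_natSinv_lt (PosNum e0)).
(* Once [t <= n], [k] is at most [n (n+1) + (n+1) = (n+1)^2]. *)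
have kn : (k <= n.+1 ^ 2)%N.
  have tn : t <= n%:R.
    near: n; exists (Num.truncn t).+1 => // m /= tm.
    by rewrite (le_trans (ltW (truncnS_gt _)))// ler_nat.
  rewrite -(@ler_nat R) natrX; have := kt.
  rewrite /grid ler_pdivrMr// => /le_trans; apply.
  rewrite mulrDl mulVf ?lt0r_neq0// expr2 -{2}[n.+1%:R]natr1 mulrDl mul1r.
  by rewrite lerD ?ler_wpM2r// ler1n.
apply: (@le_trans _ _ `|X (grid n k) x|).
  apply/ltW/He => //=; rewrite /ball_/= distrC gtr0_norm ?subr_gt0//.
  by rewrite ltrBlDl (le_lt_trans kt)// ltrD2l.
exact: (@runmax_ub _ _ (fun j => `|X (grid n j) x|)).
Unshelve. all: by end_near. Qed.

(** An equality at every [x], so the supremum over uncountably many times becomes a lower limit of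
    measurable functions, ready for Fatou's lemma. *)
Lemma maximal_fun_grid p (w : T -> R) x : 0 < p -> 0 < w x ->
  (poweR (maximal_fun X x) p * (w x)%:E)%E =
  limn_einf (fun n => (grid_max n x `^ p * w x)%:E).
Proof.
move=> p0 w0; have max0 : (0 <= maximal_fun X x)%E.
  apply: le_trans (grid_max_le 0%N x); rewrite lee_fin; exact: grid_max_ge0.
apply/eqP; rewrite eq_le; apply/andP; split; last first.
  apply: limn_einf_le => n; rewrite EFinM lee_wpmul2r ?lee_fin//; first exact: ltW.
  rewrite -poweR_EFin gt0_ler_poweR ?in_itv/= ?andbT ?leey ?lee_fin//.
  - exact: ltW.
  - by rewrite grid_max_ge0.
  - by rewrite max0.
  - exact: grid_max_le.
set L := limn_einf _; have L0 : (0 <= L)%E.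
  by apply: limn_einf_ge; apply: nearW => n; rewrite lee_fin mulr_ge0 ?powR_ge0 ?ltW.
have key t c : 0 <= t -> 0 <= c -> c < `|X t x| -> ((c `^ p * w x)%:E <= L)%E.
  move=> t0 c0 ct; apply: limn_einf_ge.
  apply: filterS (near_grid_max t0 ct) => n cn.
  rewrite lee_fin ler_wpM2r ?(ltW w0)// ge0_ler_powR ?nnegrE ?grid_max_ge0//.
  exact: ltW.
case: (L) L0 key => [l| |] // l0 key; last by rewrite leey.
(* [b] solves [b^p w = l]. If some [|X t x|] exceeded [b], the midpoint [c] between them would
   satisfy [c^p w <= l = b^p w], contradicting [b < c]. *)
rewrite lee_fin in l0; pose b := (l / w x) `^ p^-1.
have b0 : 0 <= b by exact: powR_ge0.
have bp : b `^ p = l / w x.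
  by rewrite /b -powRrM mulVf ?lt0r_neq0// powRr1// divr_ge0// ltW.
have maxb : (maximal_fun X x <= b%:E)%E.
  apply: ge_ereal_sup => _ [t t0 <-]; rewrite lee_fin leNgt; apply/negP => bX.
  pose c := (b + `|X t x|) / 2.
  have bc : b < c by rewrite /c; lra.
  have cX : c < `|X t x| by rewrite /c; lra.
  have c0 : 0 <= c by rewrite ltW// (le_lt_trans b0).
  have := key t c t0 c0 cX; rewrite lee_fin -ler_pdivlMr// -bp leNgt => /negP; apply.
  by rewrite gt0_ltr_powR ?nnegrE.
apply: (@le_trans _ _ (poweR b%:E p * (w x)%:E)%E).
  rewrite lee_wpmul2r ?lee_fin ?(ltW w0)//.
  rewrite gt0_ler_poweR ?in_itv/= ?andbT ?leey ?lee_fin//.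
  - exact: ltW.
  - by rewrite max0.
  - by rewrite b0.
by rewrite poweR_EFin bp -EFinM mulfVK ?lt0r_neq0.
Qed.

End maximal_function.

Theorem theorem2 (R : realType) (d : measure_display) (T : measurableType d)
  (P : probability T R) (F : R -> set (set T))
  (V : completeNormedModType R) (ip : V -> V -> R)
  (X : R -> T -> V) (Xinf : T -> V) (wt : R -> T -> R) (w : T -> R) (p : R) :
  1 < p ->
  complete_space P ->
  is_filtration F -> right_continuous_filtration F -> F0_contains_null P F ->
  is_inner_product ip -> separable_space V ->
  H_martingale P ip F X -> H_unif_integrable P X -> cadlag X ->
  H_closure P ip F X Xinf ->
  weight P F wt w -> (Qp P F p w < +oo)%E ->
  (poweR (\int[P]_x (poweR (maximal_fun X x) p * (w x)%:E)) p^-1 <=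
   ((p `^ (p / (p - 1)) / (p - 1)) * (fine (Qp P F p w)) `^ (p - 1)^-1)%:E *
   poweR (\int[P]_x ((`|Xinf x| `^ p) * w x)%:E) p^-1)%E.
Proof.
move=> p1 _ filF _ _ ipP sepV mX _ cadX cX wP Qoo.
have p0 : 0 < p by lra.
have pB0 : 0 < p - 1 by lra.
have w0 := weight_gt0 wP.
have mw := measurable_weight filF wP.
have rcX x t : 0 <= t -> X s x @[s --> t^'+] --> X t x.
  by move=> t0; case: (cadX x) => + _; apply.
set C := (_ / _ * _); set I := (\int[P]_x ((`|Xinf x| `^ p) * w x)%:E)%E.
have C0 : 0 <= C by rewrite !mulr_ge0 ?powR_ge0 ?invr_ge0 ?ltW.
have I0 : (0 <= I)%E.
  by apply: integral_ge0 => x _; rewrite lee_fin mulr_ge0 ?powR_ge0 ?ltW.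
have main : (\int[P]_x (poweR (maximal_fun X x) p * (w x)%:E) <= (C `^ p)%:E * I)%E.
  under eq_integral do rewrite (maximal_fun_grid rcX p0 (w0 _)).
  apply: (le_trans (fatou _ _ _ _)) => //.
  - move=> n; apply/measurable_EFinP/measurable_funM => //.
    apply: measurable_fun_powR; apply: measurable_runmax => j _.
    have sF := filtration_sub_sigma filF (@grid_ge0 R n j).
    apply: (sub_sigma_measurable_fun sF); apply: meas_in_measurable_fun => //.
    apply: (meas_in_comp (g := @Num.norm _ V)); first exact: norm_continuous.
    by case: mX => + _; apply; exact: grid_ge0.
  - by move=> n x _; rewrite lee_fin mulr_ge0 ?powR_ge0 ?ltW.
  apply: limn_einf_le => n.
  apply: (discrete_maximal_inequality filF ipP sepV mX cX p1 wP Qoo).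
  - by move=> j; exact: grid_ge0.
  - by move=> i j ij; rewrite ler_wpM2r ?invr_ge0 ?ler_nat.
have -> : C%:E = poweR (C `^ p)%:E p^-1.
  by rewrite poweR_EFin -powRrM divff ?lt0r_neq0// powRr1.
rewrite -poweRM ?lee_fin ?powR_ge0//.
rewrite gt0_ler_poweR ?in_itv/= ?andbT ?leey//.
- by rewrite invr_ge0 ltW.
- rewrite integral_ge0// => x _.
  by rewrite mule_ge0 ?poweR_ge0// lee_fin ltW.
- by rewrite mule_ge0// lee_fin powR_ge0.
Qed.
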